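(* Let $\alpha>1$ be an even integer, let $W(x)=e^{-\pi|x|^\alpha}$, let $s>1-\frac1\alpha$ and $p,q>0$. For $n\ge 1$ let $X_n$ be the set of the $n$ zeros of $h_n$ (equivalently of $H_n$), and let $\omega(x)=W(x)\big(\sum_{k=0}^n|h_k(x)|^2\big)^{-1}$ for $x\in X_n$. Then there are constants, independent of $n$, such that for all $n\geq 1$ $$\sup_{\substack{f\in \mathbb{H}^s\\ \|f\|_{\mathbb{H}^s}\leq 1}}\left|\int_{-\infty}^\infty f(x)W(x)\,\mathrm{d}x-\sum_{x\in X_n}\omega(x)f(x)\right|^2\lesssim n^{-s+1-\frac{1}{\alpha}},$$ $$\sup_{\substack{f\in \mathbb{E}^{p}_{q}\\ \|f\|_{\mathbb{E}^{p}_{q}}\leq 1}}\left|\int_{-\infty}^\infty f(x)W(x)\,\mathrm{d}x-\sum_{x\in X_n}\omega(x)f(x)\right|^2\lesssim e^{-q(2n)^p}\,n^{\frac{1}{3}-\frac{1}{\alpha}+\max(1-p,0)}.$$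
   Context: $\mathbb{N}=\{0,1,2,\dots\}$. $H_k$ ($k\in\mathbb N$, $\deg H_k=k$) are the orthonormal polynomials with respect to the weight $W(x)^2$ on $\mathbb{R}$ (real, say with positive leading coefficient), and $h_k=H_kW$, so that $\{h_k\}_{k\in\mathbb{N}}$ is an orthonormal basis of $L^2(\mathbb{R})$. For $f\in L^2(\mathbb{R})$ put $\hat f_k=\langle f,h_k\rangle_{L^2(\mathbb{R})}$. Define $\mathbb{H}^s=\{f\in L^2(\mathbb{R}):\|f\|_{\mathbb{H}^s}<\infty\}$ with $\|f\|_{\mathbb{H}^s}^2=\sum_{k\in\mathbb{N}}(1+k)^s|\hat f_k|^2$, and $\mathbb{E}^p_q=\{f\in L^2(\mathbb{R}):\|f\|_{\mathbb{E}^p_q}<\infty\}$ with $\|f\|_{\mathbb{E}^p_q}^2=\sum_{k\in\mathbb{N}}e^{qk^p}|\hat f_k|^2$. For the stated parameter ranges these are reproducing kernel Hilbert spaces; the point value $f(x)$ refers to the continuous representative $f(x)=\sum_k\hat f_kh_k(x)$. $A\lesssim B$ means $A\le CB$ with a constant $C>0$ (here possibly depending on $\alpha,s,p,q$ but not on $n$). *)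

(* Defs.v *)
From mathcomp Require Import all_boot all_order all_algebra.
From mathcomp Require Import complex.
From mathcomp Require Import all_classical all_reals all_analysis.

Set Implicit Arguments.
Unset Strict Implicit.
Unset Printing Implicit Defensive.

Import Order.TTheory GRing.Theory Num.Theory.
Import numFieldNormedType.Exports.

Local Open Scope classical_set_scope.
Local Open Scope complex_scope.
Local Open Scope ring_scope.

Notation leb R := (@lebesgue_measure R).
Notation cRe := complex.Re.
Notation cIm := complex.Im.
Notation cmod := ComplexField.Normc.normc.

(** [R[i]] carries neither a measurable nor a topological structure in the
    libraries, so measurability, integrals and sums of series are taken
    componentwise. *)

Definition is_L2 (R : realType) (f : R -> R[i]) : Prop :=
  [/\ measurable_fun [set: R] (fun x => cRe (f x)),
      measurable_fun [set: R] (fun x => cIm (f x)) &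
      finite_norm (leb R) 2%:E (fun x => cmod (f x))].

Definition cintegral (R : realType) (f : R -> R[i]) : R[i] :=
  (\int[leb R]_(x in [set: R]) cRe (f x))
    +i* (\int[leb R]_(x in [set: R]) cIm (f x)).

Definition cseries (R : realType) (u : nat -> R[i]) : R[i] :=
  (limn (series (fun k => cRe (u k)))) +i* (limn (series (fun k => cIm (u k)))).

Definition inner (R : realType) (f g : R -> R[i]) : R[i] :=
  cintegral (fun x => f x * conjc (g x)).

Definition weight (R : realType) (alpha : nat) (x : R) : R :=
  expR (- (pi * `|x| ^+ alpha)).

(** These conditions determine [H] uniquely. *)
Definition orthonormal_polys (R : realType) (W : R -> R)
    (H : nat -> {poly R}) : Prop :=
  [/\ forall k, size (H k) = k.+1,
      forall k, 0 < lead_coef (H k) &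
      forall j k, \int[leb R]_(x in [set: R]) ((H j).[x] * (H k).[x] * W x ^+ 2)
                  = (j == k)%:R].

Definition hfun (R : realType) (W : R -> R) (H : nat -> {poly R})
    (k : nat) (x : R) : R := (H k).[x] * W x.

(** From here on [h] is meant to be the orthonormal basis [hfun W H]. *)
Definition coef (R : realType) (h : nat -> R -> R) (f : R -> R[i]) (k : nat) :
    R[i] :=
  inner f (fun x => (h k x)%:C).

(** An element of [L^2] is represented by an arbitrary measurable function [f];
    its values at points are those of the continuous representative, which the
    expansion of [f] in [h] gives. *)
Definition cont_rep (R : realType) (h : nat -> R -> R) (f : R -> R[i]) (x : R) :
    R[i] :=
  cseries (fun k => coef h f k * (h k x)%:C).

Definition wnorm (R : realType) (h : nat -> R -> R) (w : nat -> R)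
    (f : R -> R[i]) : \bar R :=
  sqrte (\sum_(0 <= k <oo) (w k * cmod (coef h f k) ^+ 2)%:E)%E.

Definition Hs_norm (R : realType) (h : nat -> R -> R) (s : R) :
    (R -> R[i]) -> \bar R :=
  wnorm h (fun k => (1 + k%:R) `^ s).

Definition Epq_norm (R : realType) (h : nat -> R -> R) (p q : R) :
    (R -> R[i]) -> \bar R :=
  wnorm h (fun k => expR (q * k%:R `^ p)).

Definition Hs_space (R : realType) (h : nat -> R -> R) (s : R) :
    set (R -> R[i]) :=
  [set f | is_L2 f /\ (Hs_norm h s f < +oo)%E].

Definition Epq_space (R : realType) (h : nat -> R -> R) (p q : R) :
    set (R -> R[i]) :=
  [set f | is_L2 f /\ (Epq_norm h p q f < +oo)%E].

Definition nodes (R : realType) (h : nat -> R -> R) (n : nat) : set R :=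
  [set x | h n x = 0].

Definition omega (R : realType) (W : R -> R) (h : nat -> R -> R) (n : nat)
    (x : R) : R :=
  W x * (\sum_(0 <= k < n.+1) `|h k x| ^+ 2)^-1.

Definition quad_error (R : realType) (W : R -> R) (h : nat -> R -> R) (n : nat)
    (f : R -> R[i]) : R[i] :=
  cintegral (fun x => f x * (W x)%:C)
  - \sum_(x \in nodes h n) ((omega W h n x)%:C * cont_rep h f x).

(* Main.v *)
Require Import Defs.
From HB Require Import structures.
From mathcomp Require Import all_boot all_order all_algebra.
From mathcomp Require Import complex.
From mathcomp Require Import all_classical all_reals all_analysis.
From mathcomp Require Import measurable_realfun.
From mathcomp Require Import ring lra.

Set Implicit Arguments.
Unset Strict Implicit.
Unset Printing Implicit Defensive.

Import Order.TTheory GRing.Theory Num.Theory.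
Import numFieldNormedType.Exports.

Local Open Scope classical_set_scope.
Local Open Scope ring_scope.

(** Write [L P] for the integral of [P W^2], so that the [H k] are orthonormal
    for [L], and [h_k = H_k W].  The rule is Gauss quadrature in disguise: with
    [P = f / W] it reads [sum_x cotes x * P x], where [cotes] is the Christoffel
    function, and it is exact on polynomials of degree less than [2n]
    ([gauss_quad_exact]).  Hence it integrates [h_k W] exactly for [k < 2n], and
    the error on [f = sum_k f_k h_k] is minus the sum over [k >= 2n] of
    [f_k Q_k], where [Q_k = sum_x omega(x) h_k(x)] is the Gauss sum of [H_k].
    By Cauchy-Schwarz the squared error is at most the squared norm of [f]
    times the tail of [sum_k Q_k^2 / w_k], [w_k] being the weights of the norm
    ([quadrature_error_real]).  Everything thus rests on

      [Q_k^2 <= C k^(-1/alpha)],  uniformly in [k >= 1] and [n]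
      ([gauss_H_decay]);

    what remains is the estimation of the tails of [sum k^(-s-1/alpha)] and
    [sum exp(-q k^p)] ([Hs_tail], [Epq_tail]).

    The bound on [Q_k] is Cauchy-Schwarz again, from two facts.

    First, [h_k(x)^2 <= C k^(-1/alpha) (1+|x|)^alpha] for all [x]
    ([h_sqr_decay]).  The pair [(f, g) = (h_k, h_(k-1))] solves a linear system
    of Hamiltonian form ([ladder_down], [ladder_up]) with quadratic Hamiltonian
    [N1 g^2 + N2 f^2 - 2 beta f g], whose derivative along a solution only
    involves the derivatives of the coefficients ([hamiltonian_deriv]).  The
    recurrence coefficients satisfy [b_k ~ k^(1/alpha)]: this follows from the
    identity [k = 2 pi alpha b_k L(x^(alpha-1) H_k H_(k-1))]
    ([string_equation]) and the positivity of the moments [L(x^m H_j H_l)],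
    which are weighted counts of lattice paths.  On [|x| <= c k^(1/alpha)] the
    Hamiltonian is therefore comparable to [k^(1-1/alpha) (f^2+g^2)], and its logarithmic derivative is
    [O(k^(-1/alpha))], so that it is constant up to a factor on the whole
    interval; as [f^2+g^2] has integral 2, it is [O(k^(-1/alpha))] there.
    Farther out a crude form of the same argument on short intervals loses a
    power of [k], which is smaller than a power of [|x|].

    Second, [sum_x omega(x) (1+|x|)^alpha] is bounded uniformly in [n]
    ([weights_bound]).  Indeed [omega = cotes / W], and [1/W] is a power series
    with nonnegative coefficients, while the Gauss sum of a monomial never
    exceeds its integral ([gauss_quad_power_le]): both count lattice paths, the
    former only those that stay below height [n].  So the sum is at most the
    integral of [(1+x^alpha) W] up to a constant. *)

(** * Two elementary estimates *)

(** The coefficient bound [|P_i| y^i <= C] expresses that [P] behaves like a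
    form of fixed degree in [x] and a length scale [y]: then [P], and [y] times
    its derivative, have size [C] on [|x| <= y]. *)
Section HomogeneousBounds.
Variable R : realFieldType.
Variables (P : {poly R}) (e : nat) (C x y : R).
Hypothesis size_P : (size P <= e.+1)%N.
Hypothesis y_gt0 : 0 < y.
Hypothesis x_le : `|x| <= y.
Hypothesis P_le : forall i, `|P`_i| * y ^+ i <= C.

Lemma hom_horner_le : `|P.[x]| <= e.+1%:R * C.
Proof.
rewrite (horner_coef_wide _ size_P) mulr_natl -[e.+1 in leRHS]card_ord -sumr_const.
apply: le_trans (ler_norm_sum _ _ _) _; apply: ler_sum => i _.
rewrite normrM normrX (le_trans _ (P_le i))// ler_wpM2l//.
by rewrite lerXn2r ?nnegrE// ltW.
Qed.

Lemma hom_horner0_le : P`_0 = 0 -> `|P.[x]| * y <= `|x| * (e.+1%:R * C).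
Proof.
move=> P0; rewrite (horner_coef_wide _ size_P) big_ord_recl P0 mul0r add0r.
have C0 : 0 <= C by rewrite (le_trans _ (P_le 0))// mulr_ge0// exprn_ge0// ltW.
apply: (@le_trans _ _ (`|x| * (e%:R * C))); last first.
  by rewrite ler_wpM2l// ler_wpM2r// ler_nat.
rewrite mulr_natl -[e in leRHS]card_ord -sumr_const mulr_sumr.
rewrite (le_trans (ler_wpM2r (ltW y_gt0) (ler_norm_sum _ _ _)))// mulr_suml.
apply: ler_sum => i _; rewrite /= /bump /= add1n exprS !normrM normrX.
rewrite mulrCA -mulrA ler_wpM2l// (le_trans _ (P_le i.+1))// exprSr mulrA.
by rewrite ler_wpM2r ?(ltW y_gt0)// ler_wpM2l// lerXn2r ?nnegrE// ltW.
Qed.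

Lemma hom_deriv_le : `|P^`().[x]| * y <= e.+1%:R ^+ 2 * C.
Proof.
have C0 : 0 <= C by rewrite (le_trans _ (P_le 0))// mulr_ge0// exprn_ge0// ltW.
have sP : (size P^`() <= e)%N.
  by rewrite (leq_trans (size_poly _ _))//; case: (size P) size_P.
rewrite (horner_coef_wide _ sP).
apply: (@le_trans _ _ (e%:R * (e%:R * C))); last first.
  by rewrite expr2 -mulrA ler_pM ?mulr_ge0 ?ler_nat// ler_wpM2r// ler_nat.
rewrite mulr_natl -[e in X in _ <= _ *+ X]card_ord -sumr_const.
rewrite (le_trans (ler_wpM2r (ltW y_gt0) (ler_norm_sum _ _ _)))// mulr_suml.
apply: ler_sum => i _; rewrite coef_deriv -[P`_i.+1 *+ _]mulr_natl !normrM normr_nat normrX.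
rewrite -!mulrA ler_pM ?mulr_ge0 ?exprn_ge0 ?ler_nat ?(ltW y_gt0)//.
rewrite (le_trans _ (P_le i.+1))// exprSr ler_wpM2l// ler_wpM2r ?(ltW y_gt0)//.
by rewrite lerXn2r ?nnegrE// ltW.
Qed.

End HomogeneousBounds.

Section QuadraticForms.
Variable R : realFieldType.
Variables r f d p q n : R.

Let cross_le (e m : R) : 2 * `|e| <= m ->
  2 * `|e * (p * q)| <= m / 2 * (p ^+ 2 + q ^+ 2).
Proof.
move=> em; rewrite normrM mulrA (le_trans (ler_wpM2r _ em))//.
have m0 : 0 <= m by rewrite (le_trans _ em)// mulr_ge0.
rewrite -mulrA ler_wpM2l// normrM.
rewrite -[p ^+ 2]real_normK ?num_real// -[q ^+ 2]real_normK ?num_real//.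
have := sqr_ge0 (`|p| - `|q|); rewrite sqrrB; lra.
Qed.

(** The cross term takes at most half of the diagonal, as
    [2 |p q| <= p^2 + q^2]. *)
Lemma quad_form_ge : n <= r -> n <= f -> `|d| <= n / 2 ->
  n / 2 * (p ^+ 2 + q ^+ 2) <= r * q ^+ 2 + f * p ^+ 2 - 2 * (d * (p * q)).
Proof.
move=> nr nf dn; have n0 : 0 <= n / 2 := le_trans (normr_ge0 _) dn.
have := sqr_ge0 p; have := sqr_ge0 q; set P := p ^+ 2; set Q := q ^+ 2 => Q0 P0.
have := @cross_le d n; rewrite -/P -/Q => /(_ _)/wrap[|c]; first by lra.
have := ler_norm (d * (p * q)).
have : n * Q <= r * Q by rewrite ler_wpM2r.
have : n * P <= f * P by rewrite ler_wpM2r.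
lra.
Qed.

Lemma quad_form_le : `|r| <= n -> `|f| <= n -> `|d| <= n ->
  `|r * q ^+ 2 + f * p ^+ 2 - 2 * (d * (p * q))| <= 2 * n * (p ^+ 2 + q ^+ 2).
Proof.
move=> rn fn dn; have := @cross_le d (2 * n); rewrite ler_wpM2l// => /(_ isT).
move: (p ^+ 2) (q ^+ 2) (sqr_ge0 p) (sqr_ge0 q) => P Q P0 Q0 {}dn.
rewrite (le_trans (ler_normB _ _))// (le_trans (lerD (ler_normD _ _) (lexx _)))//.
rewrite [`|r * _|]normrM [`|f * _|]normrM [`|2 * _|]normrM [`|2|]ger0_norm//.
rewrite (ger0_norm P0) (ger0_norm Q0).
have : `|r| * Q <= n * Q by rewrite ler_wpM2r.
have : `|f| * P <= n * P by rewrite ler_wpM2r.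
lra.
Qed.

End QuadraticForms.

(** * Orthonormal polynomials for an even functional *)

Section OrthonormalPolynomials.
Variables (R : realFieldType) (L : {scalar {poly R}}) (H : nat -> {poly R}).
Hypothesis size_H : forall k, size (H k) = k.+1.
Hypothesis lead_H : forall k, 0 < lead_coef (H k).
Hypothesis H_orthonormal : forall j k, L (H j * H k) = (j == k)%:R.
Hypothesis L_even : forall P, L (P \Po - 'X) = L P.

Lemma exists_coords n (P : {poly R}) : (size P <= n)%N ->
  exists c : nat -> R, P = \sum_(k < n) c k *: H k.
Proof.
elim: n P => [|n IH] P.
  by rewrite leqn0 size_poly_eq0 => /eqP->; exists (fun=> 0); rewrite big_ord0.
move=> sP; set a := P`_n / lead_coef (H n).
have [|c Pc] := IH (P - a *: H n).
  apply/leq_sizeP => j; rewrite leq_eqVlt => /predU1P[<-|nj].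
    rewrite coefB coefZ /a lead_coefE size_H /= divfK ?subrr //.
    by have := lead_H n; rewrite lead_coefE size_H /= => /gt_eqF->.
  rewrite coefB coefZ [P`_j]nth_default ?[(H n)`_j]nth_default ?mulr0 ?subrr//.
    by rewrite size_H.
  exact: leq_trans sP nj.
exists (fun k => if k == n then a else c k).
rewrite big_ord_recr /= eqxx -[LHS](subrK (a *: H n)) Pc; congr (_ + _).
by apply: eq_bigr => i _; rewrite ltn_eqF.
Qed.

Lemma L_sum_coords n (c : nat -> R) j :
  L ((\sum_(k < n) c k *: H k) * H j) = if (j < n)%N then c j else 0.
Proof.
rewrite mulr_suml linear_sum /=.
under eq_bigr => i _ do rewrite -scalerAl linearZ /= H_orthonormal.
case: ltnP => jn.
  rewrite (bigD1 (Ordinal jn)) //= eqxx mulr1 big1 ?addr0 // => i.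
  by rewrite -val_eqE /= => /negPf->; rewrite mulr0.
by rewrite big1 // => i _; rewrite ltn_eqF ?mulr0// (leq_trans (ltn_ord i)).
Qed.

Lemma expand_H n (P : {poly R}) : (size P <= n)%N ->
  P = \sum_(k < n) L (P * H k) *: H k.
Proof.
move=> /exists_coords[c ->]; apply: eq_bigr => k _.
by rewrite L_sum_coords ltn_ord.
Qed.

Lemma L_orth k (P : {poly R}) : (size P <= k)%N -> L (P * H k) = 0.
Proof. by move=> /exists_coords[c ->]; rewrite L_sum_coords ltnn. Qed.

Lemma L_top_coef n (P : {poly R}) : (size P <= n.+1)%N ->
  L (P * H n) * lead_coef (H n) = P`_n.
Proof.
move=> /exists_coords[c ->]; rewrite L_sum_coords leqnn coef_sum big_ord_recr /=.
rewrite big1 ?add0r ?coefZ ?lead_coefE ?size_H// => i _.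
by rewrite coefZ [_`_n]nth_default ?mulr0// size_H.
Qed.

(** [H k (-x)] is orthogonal to all lower degrees, hence proportional to
    [H k]. *)
Lemma H_parity k : H k \Po - 'X = (-1) ^+ k *: H k.
Proof.
have sX : size (- 'X : {poly R}) = 2 by rewrite size_polyN size_polyX.
have sP j : size (H j \Po - 'X) = j.+1 by rewrite size_comp_poly2.
have E : H k \Po - 'X = L ((H k \Po - 'X) * H k) *: H k.
  rewrite {1}[LHS](@expand_H k.+1) ?sP// big_ord_recr /= big1 ?add0r// => i _.
  rewrite -L_even comp_polyM -comp_polyA.
  rewrite (_ : - 'X \Po - 'X = 'X) ?comp_polyXr; last first.
    by rewrite -scaleN1r comp_polyZ comp_polyX scalerA mulN1r opprK scale1r.
  by rewrite mulrC L_orth ?scale0r// sP.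
have : lead_coef (H k \Po - 'X) = (-1) ^+ k * lead_coef (H k).
  by rewrite lead_coef_comp ?sX// size_H lead_coefN lead_coefX mulrC.
by rewrite E lead_coefZ => /(mulIf (lt0r_neq0 (lead_H k)))->.
Qed.

(** The matrix entries of multiplication by [x^m] in the basis [H].  Since
    multiplication by [x] is a Jacobi matrix with zero diagonal and positive
    off-diagonal entries [jacobi], they are weighted counts of the lattice paths
    of [m] steps from [j] to [l]. *)
Definition moment m j l : R := L ('X^m * H j * H l).

(** At index 0, where [k.-1 = 0], parity makes this moment vanish, so that the
    three-term recurrence holds for [k = 0] too. *)
Definition jacobi k : R := moment 1 k.-1 k.

Lemma moment0 j l : moment 0 j l = (j == l)%:R.
Proof. by rewrite /moment expr0 mul1r H_orthonormal. Qed.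

Lemma moment_sym m j l : moment m j l = moment m l j.
Proof. by rewrite /moment mulrAC. Qed.

Lemma moment_odd m j l : odd (m + j + l) -> moment m j l = 0.
Proof.
move=> o; have : moment m j l = - moment m j l.
  rewrite {1}/moment -L_even !comp_polyM !H_parity.
  have -> : 'X^m \Po - 'X = (-1) ^+ m *: 'X^m :> {poly R}.
    by rewrite comp_Xn_poly -scaleN1r exprZn.
  rewrite -!scalerAl -!scalerAr -scalerAl !scalerA -!exprD linearZ /=.
  rewrite -signr_odd !oddD; move: o; rewrite !oddD.
  by case: (odd m); case: (odd j); case: (odd l) => //= _; rewrite expr1 mulN1r.
lra.
Qed.

Lemma jacobi0 : jacobi 0 = 0. Proof. exact: moment_odd. Qed.

Lemma H_neq0 k : H k != 0.
Proof. by rewrite -size_poly_eq0 size_H. Qed.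

Lemma size_XH k : size ('X * H k) = k.+2.
Proof. by rewrite mulrC size_mulX ?H_neq0// size_H. Qed.

Lemma H_rec k : 'X * H k = jacobi k.+1 *: H k.+1 + jacobi k *: H k.-1.
Proof.
rewrite (@expand_H k.+2 ('X * H k)) ?size_XH// big_ord_recr /= addrC; congr (_ + _).
rewrite big_ord_recr /= -{1}['X]expr1 -/(moment 1 k k) moment_odd ?scale0r ?addr0.
  case: k => [|k]; first by rewrite big_ord0 jacobi0 scale0r.
  rewrite big_ord_recr /= /jacobi moment_sym /moment expr1 big1 ?add0r// => i _.
  by rewrite mulrAC L_orth ?scale0r// size_XH ltnS.
by rewrite -addnA addnn oddD odd_double.
Qed.

Lemma jacobi_lead k : jacobi k.+1 * lead_coef (H k.+1) = lead_coef (H k).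
Proof.
rewrite /jacobi /moment expr1 L_top_coef.
  by rewrite mulrC coefMX /= lead_coefE size_H.
by rewrite size_XH.
Qed.

Lemma jacobi_gt0 k : 0 < jacobi k.+1.
Proof. by rewrite -(pmulr_lgt0 _ (lead_H k.+1)) jacobi_lead. Qed.

Lemma jacobi_ge0 k : 0 <= jacobi k.
Proof. by case: k => [|k]; rewrite ?jacobi0// ltW// jacobi_gt0. Qed.

Lemma momentS m j l : moment m.+1 j l =
  jacobi j.+1 * moment m j.+1 l + jacobi j * moment m j.-1 l.
Proof.
rewrite /moment exprSr -!mulrA [in LHS](mulrA 'X) H_rec mulrDl mulrDr raddfD /=.
by rewrite -!scalerAl -!scalerAr !linearZ.
Qed.

Lemma moment_ge0 m j l : 0 <= moment m j l.
Proof.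
elim: m j => [|m IH] j; first by rewrite moment0.
by rewrite momentS addr_ge0// mulr_ge0 ?jacobi_ge0 ?IH.
Qed.

(** There are at most [2 ^ m] paths of [m] steps, and none of them leaves the
    range where the bound on the coefficients is assumed. *)
Lemma moment_le m j l (B : R) : (forall i, (i <= j + m)%N -> jacobi i <= B) ->
  moment m j l <= (2 * B) ^+ m.
Proof.
elim: m j => [|m IH] j bB; first by rewrite moment0 expr0 lern1; case: eqP.
have B0 : 0 <= B by rewrite (le_trans (jacobi_ge0 0))// bB.
rewrite momentS exprS -mulrA mulr_natl mulr2n lerD// ler_pM ?jacobi_ge0 ?moment_ge0//.
- by apply: bB; rewrite addnS ltnS leq_addr.
- by apply: IH => i ij; apply: bB; rewrite addnS -addSn.
- by apply: bB; rewrite leq_addr.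
- apply: IH => i ij; apply: bB; apply: leq_trans ij _.
  by rewrite leq_add// leq_pred.
Qed.

(** One of the paths bounces [m] times across the edge between [k] and
    [k.+1]. *)
Lemma moment_ge_jacobi k m (e : bool) :
  jacobi k.+1 ^+ m <= moment m (k + (odd m (+) e)) (k + e).
Proof.
elim: m => [|m IH]; first by rewrite moment0 addFb eqxx.
rewrite exprS momentS /= addNb; case: (odd m (+) e) IH => /= IH.
  rewrite addn1 in IH; rewrite addn0.
  by rewrite (le_trans (ler_wpM2l (jacobi_ge0 _) IH))// lerDl mulr_ge0 ?jacobi_ge0
    ?moment_ge0.
rewrite addn0 in IH; rewrite addn1.
by rewrite (le_trans (ler_wpM2l (jacobi_ge0 _) IH))// lerDr mulr_ge0 ?jacobi_ge0
  ?moment_ge0.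
Qed.

Definition cd_kernel k (x : R) : {poly R} := \sum_(j < k) (H j).[x] *: H j.

Lemma size_cd_kernel k x : (size (cd_kernel k x) <= k)%N.
Proof.
apply/leq_sizeP => j kj; rewrite coef_sum big1// => i _.
by rewrite coefZ nth_default ?mulr0// size_H (leq_trans _ kj).
Qed.

Lemma L_cd_kernel k x (P : {poly R}) : (size P <= k)%N -> L (cd_kernel k x * P) = P.[x].
Proof.
move=> sP; rewrite {2}(expand_H sP) horner_sum mulr_suml linear_sum /=.
by apply: eq_bigr => i _; rewrite -scalerAl linearZ /= hornerZ mulrC [P * _]mulrC.
Qed.

Lemma christoffel_darboux k x : (x%:P - 'X) * cd_kernel k x =
  jacobi k *: ((H k).[x] *: H k.-1 - (H k.-1).[x] *: H k).
Proof.
elim: k => [|k IH]; first by rewrite /cd_kernel big_ord0 mulr0 jacobi0 scale0r.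
rewrite /cd_kernel big_ord_recr /= mulrDr -/(cd_kernel k x) IH -scalerAr mulrBl H_rec.
have -> : x%:P * H k = (x *: H k) by rewrite mul_polyC.
have hx : x * (H k).[x] = jacobi k.+1 * (H k.+1).[x] + jacobi k * (H k.-1).[x].
  by have := congr1 (horner^~ x) (H_rec k); rewrite !hornerE.
rewrite -!mul_polyC; have := congr1 polyC hx.
rewrite !rmorphD /= !rmorphM /= => hx'.
transitivity ((jacobi k)%:P * (((H k).[x])%:P * H k.-1 - ((H k.-1).[x])%:P * H k)
  + (x%:P * ((H k).[x])%:P) * H k - ((H k).[x])%:P *
    ((jacobi k.+1)%:P * H k.+1 + (jacobi k)%:P * H k.-1)); first by ring.
by rewrite hx'; ring.
Qed.


(** ** Gauss quadrature *)

Section GaussQuadrature.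
Variables (n : nat) (X : seq R).
Hypothesis n_gt0 : (0 < n)%N.
Hypothesis X_uniq : uniq X.
Hypothesis X_size : size X = n.
Hypothesis X_root : all (root (H n)) X.

Definition cotes (x : R) : R := (\sum_(k < n) (H k).[x] ^+ 2)^-1.
Definition gauss_quad (P : {poly R}) : R := \sum_(x <- X) cotes x * P.[x].

Let c : R := lead_coef (H 0).
Let c_neq0 : c != 0. Proof. by rewrite lt0r_neq0// lead_H. Qed.

Lemma H0E : H 0 = c%:P.
Proof. by rewrite [LHS]size1_polyC ?size_H// /c lead_coefE size_H. Qed.

Lemma H_sqr_sum_gt0 x : 0 < \sum_(k < n) (H k).[x] ^+ 2.
Proof.
rewrite (bigD1 (Ordinal n_gt0)) //= H0E hornerC ltr_wpDr ?sumr_ge0//.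
  by move=> i _; exact: sqr_ge0.
by rewrite exprn_even_gt0//= c_neq0.
Qed.

Lemma cotes_ge0 x : 0 <= cotes x.
Proof. by rewrite invr_ge0 ltW// H_sqr_sum_gt0. Qed.

Lemma X_horner x : x \in X -> (H n).[x] = 0.
Proof. by move=> /(allP X_root)/rootP. Qed.

Lemma H_dual_orthogonal x y : x \in X -> y \in X -> x != y ->
  \sum_(k < n) (H k).[x] * (H k).[y] = 0.
Proof.
move=> xX yX xy; have := congr1 (horner^~ y) (christoffel_darboux n x).
rewrite !(hornerM, hornerZ, hornerD, hornerN, hornerC, hornerX) !X_horner//.
rewrite mul0r mulr0 subrr mulr0 => /eqP; rewrite mulf_eq0 subr_eq0 (negPf xy) /=.
rewrite horner_sum => /eqP h; rewrite -[RHS]h.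
by apply: eq_bigr => i _; rewrite hornerZ.
Qed.

(** By the Christoffel-Darboux formula the square matrix with rows
    [H_k(x) / sqrt (sum_k H_k(x)^2)], [x] a node, has orthonormal rows; then its
    columns are orthonormal as well.  The square roots are avoided by leaving
    the whole weight in one of the two factors. *)
Lemma gauss_quad_orthonormal j k : (j < n)%N -> (k < n)%N ->
  gauss_quad (H j * H k) = (j == k)%:R.
Proof.
move=> jn kn; pose x (i : 'I_n) := nth 0 X i.
have xX i : x i \in X by rewrite mem_nth// X_size.
pose M1 : 'M[R]_n := \matrix_(i, l) (cotes (x i) * (H l).[x i]).
pose M2 : 'M[R]_n := \matrix_(l, i) (H l).[x i].
have M12 : M1 *m M2 = 1%:M.
  apply/matrixP => i i'; rewrite !mxE.
  under eq_bigr => l _ do rewrite !mxE -mulrA.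
  rewrite -mulr_sumr; case: eqVneq => [<-|ii'].
    by rewrite mulVf// lt0r_neq0// H_sqr_sum_gt0.
  rewrite H_dual_orthogonal ?mulr0//.
  by rewrite /x nth_uniq ?X_size ?ltn_ord.
have := congr1 (fun M : 'M[R]_n => M (Ordinal jn) (Ordinal kn)) (mulmx1C M12).
rewrite !mxE -val_eqE /= => <-; rewrite /gauss_quad (big_nth 0) big_mkord X_size.
by apply: eq_bigr => i _; rewrite !mxE hornerM mulrCA.
Qed.

Lemma gauss_quad_linear r (f : nat -> {poly R}) (u : nat -> R) (P : {poly R}) :
  {in X, forall x, P.[x] = \sum_(k < r) u k * (f k).[x]} ->
  gauss_quad P = \sum_(k < r) u k * gauss_quad (f k).
Proof.
move=> PE; rewrite /gauss_quad; under [RHS]eq_bigr => k _ do rewrite mulr_sumr.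
rewrite exchange_big /= !big_seq; apply: eq_bigr => x xX.
by rewrite PE// mulr_sumr; apply: eq_bigr => k _; rewrite mulrCA.
Qed.

Lemma gauss_quad_H k : (k < n)%N -> gauss_quad (H k) = L (H k).
Proof.
move=> kn; have -> : H k = c^-1 *: (H k * H 0).
  by rewrite H0E mulrC mul_polyC scalerA mulVf// scale1r.
rewrite linearZ /= H_orthonormal (@gauss_quad_linear 1 (fun=> H k * H 0) (fun=> c^-1)).
  by rewrite big_ord_recl big_ord0 addr0 gauss_quad_orthonormal.
by move=> x _; rewrite big_ord_recl big_ord0 addr0 hornerZ.
Qed.

(** Dividing by [H n], which vanishes at the nodes and is orthogonal to the
    quotient, leaves a remainder of degree less than [n]. *)
Lemma gauss_quad_exact (P : {poly R}) : (size P <= n.*2)%N -> gauss_quad P = L P.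
Proof.
move=> sP; set r := P %% H n; set q := P %/ H n.
have PE : P = q * H n + r by exact: divp_eq.
have sr : (size r <= n)%N by rewrite -ltnS -(size_H n) ltn_modp H_neq0.
have sq : (size q <= n)%N.
  by rewrite /q size_divp ?H_neq0// size_H /= leq_subLR addnn.
have rE := expand_H sr.
rewrite [in RHS]PE raddfD /= L_orth// add0r [in RHS]rE linear_sum /=.
under eq_bigr => k _ do rewrite linearZ /= -gauss_quad_H//.
apply: (@gauss_quad_linear n H (fun k => L (r * H k))) => x xX.
rewrite PE hornerD hornerM X_horner// mulr0 add0r {1}rE horner_sum.
by apply: eq_bigr => k _; rewrite hornerZ.
Qed.

(** The weighted count of the paths from [j] to [0] that stay below height
    [n]: at the nodes, where [H n] vanishes, multiplication by [x] acts on the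
    span of the lower [H k] as the truncated Jacobi matrix. *)
Fixpoint trunc_moment m j : R :=
  if (j < n)%N then
    if m is m'.+1 then
      jacobi j.+1 * trunc_moment m' j.+1 + jacobi j * trunc_moment m' j.-1
    else (j == 0%N)%:R
  else 0.

Lemma trunc_moment_bounds m j : 0 <= trunc_moment m j <= moment m j 0.
Proof.
elim: m j => [|m IH] j /=; case: ifP => _; rewrite ?lexx ?moment_ge0//.
  by rewrite moment0 lexx andbT.
have /andP[u0 uT] := IH j.+1; have /andP[u0' uT'] := IH j.-1.
by rewrite momentS addr_ge0 ?mulr_ge0 ?jacobi_ge0//= lerD// ler_wpM2l ?jacobi_ge0.
Qed.

Lemma trunc_moment_large m j : (n <= j)%N -> trunc_moment m j = 0.
Proof. by case: m => [|m] /=; rewrite leqNgt => /negPf->. Qed.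

Lemma node_power m x : x \in X ->
  x ^+ m * c = \sum_(j < n) trunc_moment m j * (H j).[x].
Proof.
move=> xX; elim: m => [|m IH].
  rewrite mul1r (bigD1 (Ordinal n_gt0)) //= n_gt0 mul1r big1 ?addr0.
    by rewrite H0E hornerC.
  by move=> i; rewrite -val_eqE /= => /negPf->; rewrite ltn_ord mul0r.
have E j : x * (H j).[x] = jacobi j.+1 * (H j.+1).[x] + jacobi j * (H j.-1).[x].
  have := congr1 (horner^~ x) (H_rec j).
  by rewrite !(hornerM, hornerZ, hornerD, hornerX).
rewrite exprS -mulrA IH mulr_sumr.
under eq_bigr => j _ do rewrite mulrCA E mulrDr.
under [RHS]eq_bigr => j _ do rewrite /= ltn_ord mulrDl addrC.
rewrite !big_split /=; congr (_ + _).
  have := X_horner xX; rewrite -(prednK n_gt0) => Hn0.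
  rewrite big_ord_recr /= Hn0 !mulr0 addr0 big_ord_recl jacobi0 !mul0r add0r.
  by apply: eq_bigr => i _; rewrite /= mulrCA mulrA.
have := @trunc_moment_large m n (leqnn n); rewrite -(prednK n_gt0) => un0.
rewrite big_ord_recl jacobi0 mul0r mulr0 add0r big_ord_recr /= un0 mulr0 mul0r addr0.
by apply: eq_bigr => i _; rewrite /= mulrCA mulrA.
Qed.

(** Up to a common factor both sides count paths from [0] to [0]; the left one
    omits those that reach height [n]. *)
Lemma gauss_quad_power_le m : gauss_quad 'X^m <= L 'X^m.
Proof.
have c0 : 0 < c by exact: lead_H.
have LH0 : L (H 0) = c^-1.
  have := H_orthonormal 0 0; rewrite {1}H0E mul_polyC linearZ /=.
  by move=> /(canRL (mulKf c_neq0)); rewrite mulr1.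
have -> : L 'X^m = c^-1 * (moment m 0 0 * c^-1).
  have E : 'X^m * H 0 * H 0 = c ^+ 2 *: 'X^m.
    by rewrite H0E -mul_polyC rmorphXn /=; ring.
  by rewrite /moment E linearZ /=; field.
rewrite (@gauss_quad_linear n H (fun j => c^-1 * trunc_moment m j)); last first.
  move=> x xX; rewrite hornerXn; under eq_bigr => i _ do rewrite -mulrA.
  by rewrite -mulr_sumr -node_power// mulrC mulfK.
under eq_bigr => i _ do rewrite -mulrA.
rewrite -mulr_sumr ler_pM2l ?invr_gt0// (bigD1 (Ordinal n_gt0))//= big1.
  rewrite addr0 gauss_quad_H// LH0 ler_wpM2r ?invr_ge0 ?(ltW c0)//.
  by have /andP[] := trunc_moment_bounds m 0.
move=> i; rewrite -val_eqE /= => i0; rewrite gauss_quad_H//.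
have -> : H i = c^-1 *: (H i * H 0).
  by rewrite H0E mulrC mul_polyC scalerA mulVf// scale1r.
by rewrite linearZ /= H_orthonormal (negPf i0) !mulr0.
Qed.

Lemma gauss_quad_le (P : {poly R}) : (forall i, 0 <= P`_i) -> gauss_quad P <= L P.
Proof.
move=> P0; rewrite (@gauss_quad_linear (size P) (fun i => 'X^i) (fun i => P`_i)).
  rewrite -[in leRHS](coefK P) poly_def linear_sum /=; apply: ler_sum => i _.
  by rewrite linearZ /= ler_wpM2l// gauss_quad_power_le.
by move=> x _; rewrite horner_coef; apply: eq_bigr => i _; rewrite hornerXn.
Qed.

End GaussQuadrature.

(** ** The differential system of the orthonormal functions *)

(** [L_ibp] is integration by parts for the weight
    [exp (- (v / a) x ^ a)]. *)
Section Ladder.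
Variables (v : R) (a : nat).
Hypothesis L_ibp : forall P : {poly R}, L P^`() = v * L ('X^(a.-1) * P).

(** [L (H' H)] for consecutive polynomials, computed from the leading
    coefficients and by parts. *)
Lemma string_equation k : k.+1%:R = v * jacobi k.+1 * moment a.-1 k.+1 k.
Proof.
have E : L ((H k.+1)^`() * H k) = v * moment a.-1 k.+1 k.
  have := L_ibp (H k.+1 * H k); rewrite derivM raddfD /= mulrA => <-.
  rewrite [H k.+1 * _]mulrC [X in _ + X]L_orth ?addr0//.
  by rewrite (leq_trans (leq_trans (size_poly _ _) (leq_pred _)))// size_H.
have : L ((H k.+1)^`() * H k) * lead_coef (H k) = lead_coef (H k.+1) *+ k.+1.
  rewrite L_top_coef; last by rewrite (leq_trans (size_poly _ _))// size_H.
  by rewrite coef_deriv lead_coefE size_H.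
rewrite E -(jacobi_lead k) mulrA -[_ *+ _]mulr_natl.
move=> /(mulIf (lt0r_neq0 (lead_H k.+1))) <-.
ring.
Qed.

(** [(x^(a-1) - y^(a-1)) / (x - y)] as a polynomial in [y]. *)
Definition divided_diff (x : R) : {poly R} :=
  \sum_(i < a.-1) 'X^(a.-2 - i) * x%:P ^+ i.

(** The values [L (divided_diff x * (H j * H l))] form a polynomial in [x]. *)
Definition diffquot j l : {poly R} := \poly_(i < a.-1) moment (a.-2 - i) j l.

Lemma L_diffquot (x : R) j l :
  L (divided_diff x * (H j * H l)) = (diffquot j l).[x].
Proof.
rewrite horner_poly mulr_suml linear_sum /=; apply: eq_bigr => i _.
rewrite -rmorphXn /= [_ * _%:P]mulrC mul_polyC -scalerAl linearZ /= mulrC.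
by rewrite /moment -mulrA.
Qed.

(** [P'(x)] is reproduced by the Christoffel-Darboux kernel; the derivative is
    then moved from [P] to the weight.  Subtracting the value at [x] of the
    logarithmic derivative of the weight produces a factor [x - y], which turns
    the kernel into the two terms of the Christoffel-Darboux formula. *)
Lemma deriv_cd_kernel k (x : R) (P : {poly R}) : (size P <= k.+1)%N ->
  L ((cd_kernel k x)^`() * P) = 0 ->
  P^`().[x] = v * x ^+ a.-1 * L (cd_kernel k x * P)
   - v * jacobi k * ((H k).[x] * L (divided_diff x * (H k.-1 * P))
       - (H k.-1).[x] * L (divided_diff x * (H k * P))).
Proof.
move=> sP KP; rewrite -(@L_cd_kernel k); last first.
  rewrite (leq_trans (size_poly _ _))//; case: (size P) sP => //.
have -> : cd_kernel k x * P^`() = (cd_kernel k x * P)^`() - (cd_kernel k x)^`() * P.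
  by rewrite derivM addrC addKr.
rewrite raddfB /= KP subr0 L_ibp.
set D := divided_diff x.
have -> : 'X^(a.-1) * (cd_kernel k x * P) = x ^+ a.-1 *: (cd_kernel k x * P)
   - D * ((x%:P - 'X) * cd_kernel k x) * P.
  have := subrXX 'X x%:P a.-1; rewrite -/(divided_diff x) -/D -mul_polyC rmorphXn /= => /eqP.
  rewrite subr_eq => /eqP ->; ring.
rewrite christoffel_darboux raddfB /= linearZ /=.
have -> : D * (jacobi k *: ((H k).[x] *: H k.-1 - (H k.-1).[x] *: H k)) * P =
    jacobi k *: ((H k).[x] *: (D * (H k.-1 * P)) - (H k.-1).[x] *: (D * (H k * P))).
  by rewrite -!mul_polyC; ring.
by rewrite [L (_ *: _)]linearZ /= [L (_ - _)]raddfB /= ![L (_ *: _)]linearZ /=; ring.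
Qed.

Lemma L_deriv_cd_kernel k (x : R) j : (k.-1 <= j)%N ->
  L ((cd_kernel k x)^`() * H j) = 0.
Proof.
move=> kj; rewrite L_orth//; apply: leq_trans (size_poly _ _) _.
by apply: leq_trans kj; rewrite -!subn1 leq_sub2r// size_cd_kernel.
Qed.

(** For [f = H_k sqrt(w)] and [g = H_(k-1) sqrt(w)], where [w] is the weight,
    the system reads [f' = - damp f + rise g], [g' = damp g - fall f]; the terms
    [v / 2 * x ^+ a.-1] in [ladder_down] and [ladder_up] come from the derivative
    of [sqrt(w)]. *)
Definition rise k : {poly R} := (v * jacobi k) *: diffquot k k.
Definition fall k : {poly R} := (v * jacobi k) *: diffquot k.-1 k.-1.
Definition damp k : {poly R} :=
  (v * jacobi k) *: diffquot k.-1 k + (v / 2) *: 'X^(a.-1).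

Lemma ladder_down k (x : R) : (H k)^`().[x] =
  - ((damp k).[x] - v / 2 * x ^+ a.-1) * (H k).[x] + (rise k).[x] * (H k.-1).[x].
Proof.
rewrite (@deriv_cd_kernel k x (H k)) ?size_H ?L_deriv_cd_kernel ?leq_pred//.
rewrite !L_diffquot.
rewrite L_orth ?size_cd_kernel// /damp /rise !hornerE; ring.
Qed.

Lemma ladder_up k (x : R) : (0 < k)%N -> (H k.-1)^`().[x] =
  ((damp k).[x] + v / 2 * x ^+ a.-1) * (H k.-1).[x] - (fall k).[x] * (H k).[x].
Proof.
move=> k0.
rewrite (@deriv_cd_kernel k x (H k.-1)) ?size_H ?L_deriv_cd_kernel ?prednK//.
rewrite !L_diffquot.
rewrite L_cd_kernel ?size_H ?prednK// /damp /fall !hornerE.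
have -> : diffquot k k.-1 = diffquot k.-1 k by apply/polyP => i; rewrite !coef_poly moment_sym.
by field.
Qed.

Definition hamiltonian k : {poly R} :=
  rise k * H k.-1 ^+ 2 + fall k * H k ^+ 2 - 2 *: (damp k * (H k * H k.-1)).

(** The left side, times [w], is the derivative of [hamiltonian k * w].  The
    Hamiltonian is conserved by a system with constant coefficients, so that only
    the derivatives of the coefficients survive. *)
Lemma hamiltonian_deriv k (x : R) : (0 < k)%N ->
  (hamiltonian k)^`().[x] - v * x ^+ a.-1 * (hamiltonian k).[x] =
  (rise k)^`().[x] * (H k.-1).[x] ^+ 2 + (fall k)^`().[x] * (H k).[x] ^+ 2
  - 2 * (damp k)^`().[x] * (H k).[x] * (H k.-1).[x].
Proof.
move=> /(ladder_up x); move: (ladder_down k x); rewrite /hamiltonian.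
move: (H k) (H k.-1) (rise k) (fall k) (damp k) => f g r q d f' g'.
rewrite !expr2 !(derivB, derivD, derivZ, derivM).
by rewrite !(hornerD, hornerN, hornerZ, hornerM) f' g'; field.
Qed.


(** ** Sizes of the coefficients of the system *)

(** [kappa k] is the [a]-th root of [k], the length scale of [H k]. *)
Section Scale.
Hypothesis a_gt1 : (1 < a)%N.
Hypothesis a_even : ~~ odd a.
Hypothesis v_ge1 : 1 <= v.
Variable kappa : nat -> R.
Hypothesis kappa_ge0 : forall k, 0 <= kappa k.
Hypothesis kappaX : forall k, kappa k ^+ a = k%:R.

Let a_gt0 : (0 < a)%N := ltnW a_gt1.
Let a2S : a.-1 = a.-2.+1. Proof. by rewrite prednK// -ltnS prednK. Qed.
Let a2_even : odd a.-2 = false.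
Proof. by move: a_gt1 a_even; case: (a) => [|[|]]//= n _; rewrite negbK => /negPf. Qed.
Let v_gt0 : 0 < v := lt_le_trans ltr01 v_ge1.
Let v_ge0 : 0 <= v := ltW v_gt0.

Lemma pow_le_inv (x y : R) : 0 <= x -> 0 <= y -> x ^+ a <= y ^+ a -> x <= y.
Proof. by move=> x0 y0; rewrite ler_pXn2r. Qed.

Lemma kappa_ge1 k : (0 < k)%N -> 1 <= kappa k.
Proof. by move=> k0; rewrite pow_le_inv// kappaX expr1n ler1n. Qed.

(** The bouncing path alone gives [k >= v b_k^a] in the string equation. *)
Lemma jacobi_le_kappa k : jacobi k <= kappa k.
Proof.
case: k => [|k]; first by rewrite jacobi0.
rewrite pow_le_inv ?jacobi_ge0// kappaX (string_equation k) -{1}(prednK a_gt0) exprS.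
have := @moment_ge_jacobi k a.-1 false.
have -> : odd a.-1 by move: a_even; rewrite -{1}(prednK a_gt0) /= negbK.
rewrite addTb addn1 addn0 => bT.
rewrite -mulrA (le_trans (ler_wpM2l (jacobi_ge0 _) bT))// ler_peMl//.
by rewrite mulr_ge0 ?jacobi_ge0 ?moment_ge0.
Qed.

(* A path of at most [a] steps from [k] only meets indices up to [k + a], where
   the coefficients are at most [A * kappa k]. *)
Let A : R := a.+1%:R.
Let A_ge1 : 1 <= A. Proof. by rewrite ler1n. Qed.
Let A21 : 1 <= 2 * A. Proof. by rewrite -natrM ler1n. Qed.
Let A20 : 0 <= 2 * A := le_trans ler01 A21.

Lemma jacobi_le_near k i : (0 < k)%N -> (i <= k + a)%N -> jacobi i <= A * kappa k.
Proof.
move=> k0 ik; rewrite (le_trans (jacobi_le_kappa i))// pow_le_inv// ?mulr_ge0//.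
rewrite exprMn !kappaX (@le_trans _ _ (A * k%:R))//.
  rewrite -natrM ler_nat (leq_trans ik)// mulSn leq_add2l.
  by rewrite -{1}[a]muln1 leq_mul2l k0 orbT.
by rewrite ler_wpM2r// -{1}[A]expr1 ler_eXn2l ?orbT// ltr1n.
Qed.

Lemma moment_le_near k m j l : (0 < k)%N -> (j <= k)%N -> (m <= a)%N ->
  moment m j l <= (2 * (A * kappa k)) ^+ m.
Proof.
move=> k0 jk ma; apply: moment_le => i ij; apply: jacobi_le_near => //.
by rewrite (leq_trans ij)// leq_add.
Qed.

(** In the string equation the moment is at most of order
    [kappa k ^+ a.-1]. *)
Lemma kappa_le_jacobi k : (0 < k)%N -> kappa k <= (v * (2 * A) ^+ a.-1) * jacobi k.
Proof.
case: k => // k _; have K1 : 1 <= kappa k.+1 by rewrite kappa_ge1.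
have K0 : 0 < kappa k.+1 ^+ a.-1 by rewrite exprn_gt0// (lt_le_trans ltr01).
rewrite -(ler_pM2r K0) -exprS prednK// kappaX string_equation.
rewrite [leRHS](_ : _ = v * jacobi k.+1 * (2 * (A * kappa k.+1)) ^+ a.-1).
  by rewrite ler_wpM2l ?mulr_ge0 ?jacobi_ge0// moment_le_near ?leq_pred.
rewrite [2 * (A * _)]mulrA [(2 * A * _) ^+ _]exprMn.
by rewrite mulrA [v * _ * jacobi _]mulrAC.
Qed.

Let C0 : R := 2 * (v * (2 * A) ^+ a).
Let K : R := a%:R ^+ 2 * C0.
Let c0 : R := v / (v * (2 * A) ^+ a.-1) ^+ a.-1.

Lemma ladder_coef_le k j l i (y : R) : (0 < k)%N -> (j <= k)%N -> kappa k <= y ->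
  `|((v * jacobi k) *: diffquot j l)`_i| * y ^+ i <= v * (2 * A) ^+ a * y ^+ a.-1.
Proof.
move=> k0 jk ky; have y0 : 0 <= y := le_trans (kappa_ge0 _) ky.
rewrite coefZ coef_poly; case: ltnP => ia; last first.
  by rewrite mulr0 normr0 mul0r !mulr_ge0 ?exprn_ge0.
rewrite ger0_norm; last by rewrite !mulr_ge0 ?jacobi_ge0 ?moment_ge0.
have bk : jacobi k <= 2 * A * y.
  by rewrite (le_trans (@jacobi_le_near k k k0 (leq_addr _ _)))// ler_pM// ler_peMl// ler1n.
have Tk : moment (a.-2 - i) j l <= (2 * A * y) ^+ (a.-2 - i).
  have := @moment_le_near k (a.-2 - i) j l k0 jk.
  rewrite (leq_trans (leq_subr _ _) (leq_trans (leq_pred _) (leq_pred _))).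
  move=> /(_ isT)/le_trans; apply; rewrite mulrA lerXn2r// ?nnegrE ?mulr_ge0//.
  by rewrite ler_wpM2l.
have ai : a.-1 = ((a.-2 - i).+1 + i)%N.
  by rewrite addSn subnK; [exact: a2S | rewrite -ltnS -a2S].
rewrite -!mulrA ler_wpM2l//.
apply: (@le_trans _ _ ((2 * A * y) ^+ (a.-2 - i).+1 * y ^+ i)).
  by rewrite mulrA ler_wpM2r ?exprn_ge0// exprS ler_pM ?jacobi_ge0 ?moment_ge0.
rewrite [a.-1 in leRHS]ai exprD mulrA ler_wpM2r ?exprn_ge0//.
rewrite exprMn ler_wpM2r ?exprn_ge0// ler_weXn2l//.
by apply: leq_trans (leq_pred a); rewrite [leqRHS]ai leq_addr.
Qed.

Lemma size_diffquot j l : (size (diffquot j l) <= a.-1)%N.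
Proof. exact: size_poly. Qed.

Definition ladder_coef k (P : {poly R}) :=
  [\/ P = rise k, P = fall k | P = damp k].

Lemma size_ladder_coef k P : ladder_coef k P -> (size P <= a.-1.+1)%N.
Proof.
have sd j l : (size ((v * jacobi k) *: diffquot j l) <= a.-1.+1)%N.
  exact: leq_trans (size_scale_leq _ _) (leqW (size_diffquot _ _)).
case=> ->; rewrite ?sd//.
rewrite (leq_trans (size_polyD _ _))// geq_max sd.
by rewrite (leq_trans (size_scale_leq _ _))// size_polyXn.
Qed.

Lemma coef_ladder_coef k P i (y : R) : (0 < k)%N -> kappa k <= y ->
  ladder_coef k P -> `|P`_i| * y ^+ i <= C0 * y ^+ a.-1.
Proof.
move=> k0 ky; have y0 : 0 <= y := le_trans (kappa_ge0 _) ky.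
have dbl : C0 * y ^+ a.-1 =
    v * (2 * A) ^+ a * y ^+ a.-1 + v * (2 * A) ^+ a * y ^+ a.-1.
  by rewrite /C0; ring.
have D0 : 0 <= v * (2 * A) ^+ a * y ^+ a.-1.
  by rewrite !mulr_ge0 ?exprn_ge0// (le_trans ler01).
case=> ->; rewrite dbl.
- by rewrite (le_trans (ladder_coef_le _ _ _ _ ky))// lerDl.
- by rewrite (le_trans (ladder_coef_le _ _ _ _ ky)) ?leq_pred// lerDl.
rewrite coefD (le_trans (ler_wpM2r _ (ler_normD _ _))) ?exprn_ge0// mulrDl.
rewrite lerD// ?ladder_coef_le ?leq_pred//.
rewrite coefZ coefXn; case: eqP => [->|_]; last by rewrite mulr0 normr0 mul0r.
rewrite mulr1 ler_wpM2r ?exprn_ge0// ger0_norm ?divr_ge0//.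
rewrite ler_pM ?invr_ge0 // (@le_trans _ _ 1) ?exprn_ege1//.
by rewrite invf_le1// ler1n.
Qed.

Lemma ladder_coef_horner k P (x y : R) : (0 < k)%N -> kappa k <= y -> `|x| <= y ->
  ladder_coef k P ->
  [/\ `|P.[x]| <= K * y ^+ a.-1, `|P^`().[x]| * y <= K * y ^+ a.-1
    & P`_0 = 0 -> `|P.[x]| * y <= `|x| * (K * y ^+ a.-1)].
Proof.
move=> k0 ky xy HP.
have y0 : 0 < y by rewrite (lt_le_trans _ ky)// (lt_le_trans ltr01) ?kappa_ge1.
have sP := size_ladder_coef HP.
have cP i := coef_ladder_coef i k0 ky HP.
have C0y : 0 <= C0 * y ^+ a.-1.
  by rewrite (le_trans _ (cP 0))// mulr_ge0// exprn_ge0// ltW.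
have aa : (a%:R : R) <= a%:R ^+ 2 by rewrite -natrX ler_nat -mulnn leq_pmulr.
have KE : a%:R * (C0 * y ^+ a.-1) <= K * y ^+ a.-1.
  by rewrite /K -mulrA ler_wpM2r.
split.
- by have := hom_horner_le sP y0 xy cP; rewrite prednK// => /le_trans; apply.
- by have := hom_deriv_le sP y0 xy cP; rewrite prednK// mulrA.
- move=> P0; have := hom_horner0_le sP y0 xy cP P0; rewrite prednK// => /le_trans.
  by apply; rewrite ler_wpM2l.
Qed.

(** By parity; this makes [damp] small near the origin compared to [rise] and
    [fall], which is what the positivity of the Hamiltonian needs. *)
Lemma damp0 k : (0 < k)%N -> (damp k)`_0 = 0.
Proof.
move=> k0; rewrite coefD !coefZ coefXn coef_poly.
have -> : (0 == a.-1)%N = false by case: a a_gt1 => [|[|]].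
rewrite mulr0 addr0; case: ifP; rewrite ?mulr0// subn0 moment_odd ?mulr0//.
by case: k k0 => // k _; rewrite addnS -addnA addnn /= oddD odd_double a2_even.
Qed.

(** The odd coefficients vanish by parity, the others are nonnegative. *)
Lemma diffquot_diag_ge j (x : R) : moment a.-2 j j <= (diffquot j j).[x].
Proof.
rewrite horner_poly a2S big_ord_recl expr0 mulr1 subn0 lerDl sumr_ge0// => i _.
case: (boolP (odd (lift ord0 i))) => o.
  rewrite moment_odd ?mul0r//.
  rewrite -addnA addnn oddD odd_double addbF oddB; last by case: i {o}.
  by rewrite a2_even o.
by rewrite mulr_ge0 ?moment_ge0// real_exprn_even_ge0// num_real.
Qed.

Lemma c0_gt0 : 0 < c0.
Proof.
by rewrite divr_gt0// exprn_gt0// mulr_gt0// exprn_gt0// mulr_gt0// ltr0n.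
Qed.

Lemma K_ge1 : 1 <= K.
Proof.
by rewrite /K /C0 !mulr_ege1 ?exprn_ege1 ?ler1n.
Qed.

Lemma ladder_ge k (x : R) : (0 < k)%N ->
  c0 * kappa k ^+ a.-1 <= (rise k).[x] /\ c0 * kappa k ^+ a.-1 <= (fall k).[x].
Proof.
move=> k0; set m := v * (2 * A) ^+ a.-1.
have m0 : 0 < m by rewrite mulr_gt0// exprn_gt0// mulr_gt0// ltr0n.
have low : c0 * kappa k ^+ a.-1 <= v * jacobi k * jacobi k ^+ a.-2.
  rewrite -mulrA -exprS -a2S /c0 -/m -[_ / _ * _]mulrA ler_wpM2l// mulrC.
  by rewrite ler_pdivrMr ?exprn_gt0// mulrC -exprMn lerXn2r ?nnegrE
    ?(mulr_ge0 (ltW m0)) ?jacobi_ge0 ?kappa_le_jacobi.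
have vb : 0 <= v * jacobi k by rewrite mulr_ge0 ?jacobi_ge0.
rewrite /rise /fall !hornerZ; split; apply: le_trans low _; rewrite ler_wpM2l//;
  apply: le_trans (diffquot_diag_ge _ _); case: k k0 {vb} => // k _.
- by have := @moment_ge_jacobi k a.-2 true; rewrite a2_even addn1.
- by have := @moment_ge_jacobi k a.-2 false; rewrite a2_even addn0.
Qed.

Definition energy k : {poly R} := H k ^+ 2 + H k.-1 ^+ 2.

(** The range of [x] is the one where [damp] is small against [rise] and [fall].
    The three coefficients behave like forms of degree [a.-1] in [x] and
    [kappa k], so that differentiation costs a factor [kappa k]. *)
Lemma hamiltonian_bounds : exists c m M Lam : R, [/\ 0 < c, 0 < m, 0 < M, 0 < Lam &
  forall k (x : R), (0 < k)%N -> `|x| <= c * kappa k ->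
  [/\ m * kappa k ^+ a.-1 * (energy k).[x] <= (hamiltonian k).[x],
      (hamiltonian k).[x] <= M * kappa k ^+ a.-1 * (energy k).[x]
    & `|(hamiltonian k)^`().[x] - v * x ^+ a.-1 * (hamiltonian k).[x]| * kappa k <=
      Lam * (hamiltonian k).[x]]].
Proof.
have cp := c0_gt0; have K1 := K_ge1; have K0 : 0 < K by rewrite (lt_le_trans ltr01).
(* The first component makes [|damp|] at most half the lower bound
   [c0 * kappa k ^+ a.-1] of [rise] and [fall]. *)
exists (Num.min 1 (c0 / (2 * K))), (c0 / 2), (4 * K), (4 * K / c0); split.
- by rewrite lt_min ltr01 divr_gt0// mulr_gt0.
- by rewrite divr_gt0.
- by rewrite mulr_gt0.
- by rewrite divr_gt0// mulr_gt0.
move=> k x k0 xc; have kp : 1 <= kappa k by exact: kappa_ge1.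
have k'0 : 0 < kappa k by rewrite (lt_le_trans ltr01).
have xk : `|x| <= kappa k.
  by rewrite (le_trans xc)// ger_pMl// ge_min lexx.
have xc' : `|x| <= c0 / (2 * K) * kappa k.
  by rewrite (le_trans xc)// ler_wpM2r// ge_min lexx orbT.
have [r1 r2 _] := ladder_coef_horner k0 (lexx _) xk (Or31 _ _ (erefl (rise k))).
have [f1 f2 _] := ladder_coef_horner k0 (lexx _) xk (Or32 _ _ (erefl (fall k))).
have [d1 d2 /(_ (damp0 k0)) d3] :=
  ladder_coef_horner k0 (lexx _) xk (Or33 _ _ (erefl (damp k))).
have [r3 f3] := ladder_ge x k0.
rewrite hamiltonian_deriv// /hamiltonian /energy.
have Y0 := exprn_gt0 a.-1 k'0; move: (kappa k ^+ a.-1) Y0 r1 r2 f1 f2 d1 d2 d3 r3 f3.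
move=> Y Y0 r1 r2 f1 f2 d1 d2 d3 r3 f3.
have d4 : `|(damp k).[x]| <= c0 * Y / 2.
  rewrite -(ler_pM2r k'0) (le_trans d3)//.
  rewrite (le_trans (ler_wpM2r _ xc'))//; first by rewrite mulr_ge0 ?ltW.
  by rewrite le_eqVlt; apply/orP; left; apply/eqP; field; rewrite gt_eqF.
have div_kappa z : `|z| * kappa k <= K * Y -> `|z| <= K * Y / kappa k.
  by rewrite ler_pdivlMr.
move: r2 f2 d2 => /div_kappa r2 /div_kappa f2 /div_kappa d2.
clear d3 div_kappa.
move: (rise k) (fall k) (damp k) (H k) (H k.-1) r1 f1 d1 d4 r3 f3 r2 f2 d2.
move=> rP fP dP pP qP; rewrite !(hornerD, hornerN, hornerZ, hornerM, horner_exp).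
move: (rP^`().[x]) (fP^`().[x]) (dP^`().[x]) rP.[x] fP.[x] dP.[x] pP.[x] qP.[x].
move=> r' f' d' r f d p q r1 f1 d1 d4 r3 f3 r2 f2 d2.
have low := quad_form_ge p q r3 f3 d4.
split.
- by rewrite (le_trans _ low)// le_eqVlt; apply/orP; left; apply/eqP; ring.
- rewrite (le_trans (ler_norm _))// (le_trans (quad_form_le p q r1 f1 d1))//.
  rewrite ler_wpM2r ?addr_ge0 ?sqr_ge0// -[4 * K * Y]mulrA.
  by rewrite ler_wpM2r ?(ltW (mulr_gt0 K0 Y0))// ler_nat.
- rewrite -ler_pdivlMr// -2!mulrA.
  rewrite (le_trans (quad_form_le p q r2 f2 d2))//.
  apply: (@le_trans _ _ (4 * K / c0 * (c0 * Y / 2 * (p ^+ 2 + q ^+ 2)) / kappa k)).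
    rewrite le_eqVlt; apply/orP; left; apply/eqP; field.
    by rewrite !gt_eqF.
  have K4 : 0 <= 4 * K / c0 by rewrite ltW// divr_gt0// mulr_gt0.
  by rewrite ler_wpM2r ?invr_ge0 ?(ltW k'0)// ler_wpM2l.
Qed.

(** Outside that range: a growth rate for [energy] itself, at any scale [y]. *)
Lemma energy_bound : exists2 K' : R, 0 < K' & forall k (x y : R), (0 < k)%N ->
  kappa k <= y -> `|x| <= y ->
  `|(energy k)^`().[x] - v * x ^+ a.-1 * (energy k).[x]| <=
    K' * y ^+ a.-1 * (energy k).[x].
Proof.
exists (4 * K); first by rewrite mulr_gt0// (lt_le_trans ltr01 K_ge1).
move=> k x y k0 ky xy.
have [r1 _ _] := ladder_coef_horner k0 ky xy (Or31 _ _ (erefl (rise k))).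
have [f1 _ _] := ladder_coef_horner k0 ky xy (Or32 _ _ (erefl (fall k))).
have [d1 _ _] := ladder_coef_horner k0 ky xy (Or33 _ _ (erefl (damp k))).
rewrite /energy !expr2 derivD !derivM.
rewrite !(hornerD, hornerM) ladder_up// ladder_down//.
set N := K * y ^+ a.-1 in r1 f1 d1.
move: (rise k).[x] (fall k).[x] (damp k).[x] (H k).[x] (H k.-1).[x] r1 f1 d1.
move=> r f d p q r1 f1 d1.
rewrite [X in `|X|](_ : _ = (2 * d) * q ^+ 2 + (- (2 * d)) * p ^+ 2
  - 2 * ((f - r) * (p * q))); last by field.
rewrite (le_trans (@quad_form_le _ _ _ _ p q (2 * N) _ _ _))//.
- by rewrite normrM ger0_norm// ler_wpM2l.
- by rewrite normrN normrM ger0_norm// ler_wpM2l.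
- by rewrite (le_trans (ler_normB _ _))// mulr_natl mulr2n lerD.
by rewrite /N -!expr2 le_eqVlt; apply/orP; left; apply/eqP; ring.
Qed.

End Scale.
End Ladder.
End OrthonormalPolynomials.

(** * Real zeros of orthogonal polynomials *)

Lemma no_root_sign (R : rcfType) (P : {poly R}) : (forall x, ~~ root P x) ->
  (forall x, 0 <= P.[x]) \/ (forall x, P.[x] <= 0).
Proof.
move=> nr; case: (lerP 0 P.[0]) => P0; [left|right] => x; rewrite leNgt;
  apply/negP => Px.
  have [x0|x0] := leP x 0.
    have [||y _ ry] := @poly_ivt _ P x 0 => //; last by rewrite (negPf (nr _)) in ry.
    by rewrite (ltW Px).
  have [||y _ ry] := @poly_ivt _ (- P) 0 x; rewrite ?(ltW x0)//.
    by rewrite !hornerN oppr_le0 P0 oppr_ge0 ltW.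
  by rewrite rootN (negPf (nr _)) in ry.
have [x0|x0] := leP 0 x.
  have [||y _ ry] := @poly_ivt _ P 0 x => //; last by rewrite (negPf (nr _)) in ry.
  by rewrite !ltW.
have [||y _ ry] := @poly_ivt _ (- P) x 0; rewrite ?(ltW x0)//.
  by rewrite !hornerN oppr_le0 oppr_ge0 !ltW.
by rewrite rootN (negPf (nr _)) in ry.
Qed.

(** [S] consists of the real roots of odd multiplicity; it is built by removing
    one linear factor of [P] at a time and switching the membership of its
    root. *)
Lemma sign_change_roots (R : rcfType) (P : {poly R}) : P != 0 ->
  exists S : seq R, [/\ uniq S, all (root P) S &
   let Q := P * \prod_(s <- S) ('X - s%:P) in
   (forall x, 0 <= Q.[x]) \/ (forall x, Q.[x] <= 0)].
Proof.
move: {2}(size P) (leqnn (size P)) => n; elim: n P => [|n IH] P.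
  by rewrite leqn0 size_poly_eq0 => /eqP->; rewrite eqxx.
move=> sP P0; have [[r rP]|nr] := pselect (exists r, root P r); last first.
  exists [::]; split => //=; rewrite big_nil mulr1; apply: no_root_sign => x.
  by apply/negP => xP; apply: nr; exists x.
have [p PE] := factor_theorem _ _ rP; have p0 : p != 0.
  by apply: contraNneq P0 => p0; rewrite PE p0 mul0r.
have [||S [uS rS sgn]] := IH p => //.
  by rewrite PE size_mul ?polyXsubC_eq0// size_XsubC addn2 /= in sP.
have rP' s : root p s -> root P s by move=> ps; rewrite PE rootM ps.
have [rinS|rnS] := boolP (r \in S).
  exists (rem r S); split; first exact: rem_uniq.
    by apply/allP => s /mem_rem/(allP rS)/rP'.
  by rewrite /= PE -mulrA; move: sgn; rewrite /= (big_rem r).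
exists (r :: S); split; first by rewrite /= rnS.
  by rewrite /= rP; apply/allP => s /(allP rS)/rP'.
move: sgn; rewrite /= big_cons PE.
rewrite (_ : p * ('X - r%:P) * (('X - r%:P) * _) =
  (p * \prod_(s <- S) ('X - s%:P)) * ('X - r%:P) ^+ 2); last by ring.
move: (p * _) => q [h|h]; [left|right] => x; rewrite hornerM horner_exp.
  by rewrite mulr_ge0// sqr_ge0.
by rewrite mulr_le0_ge0// sqr_ge0.
Qed.

(** Fewer than [n] sign changes would make [H n] times the product over them a
    polynomial of constant sign with vanishing integral. *)
Lemma orthogonal_roots (R : rcfType) (L : {scalar {poly R}}) (H : nat -> {poly R})
    (size_H : forall k, size (H k) = k.+1) (lead_H : forall k, 0 < lead_coef (H k))
    (H_orthonormal : forall j k, L (H j * H k) = (j == k)%:R)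
    (L_gt0 : forall P, P != 0 -> (forall x, 0 <= P.[x]) -> 0 < L P) n :
  exists X : seq R, [/\ uniq X, size X = n & forall x, (x \in X) = root (H n) x].
Proof.
have Hn0 : H n != 0 by rewrite -size_poly_eq0 size_H.
have [S [uS rS sgn]] := sign_change_roots Hn0.
have Sn : (size S <= n)%N by have := max_poly_roots Hn0 rS uS; rewrite size_H.
have [nS|nS] := ltnP (size S) n.
  set Q := \prod_(s <- S) ('X - s%:P).
  have Q0 : Q != 0 by rewrite monic_neq0// monic_prod_XsubC.
  have LQ : L (H n * Q) = 0.
    by rewrite mulrC (L_orth size_H lead_H H_orthonormal)// size_prod_XsubC.
  have HQ0 : H n * Q != 0 by rewrite mulf_neq0.
  case: sgn => /= h.
    by have := L_gt0 _ HQ0 h; rewrite LQ ltxx.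
  have := L_gt0 (- (H n * Q)); rewrite raddfN /= LQ oppr0 ltxx oppr_eq0.
  by move=> /(_ HQ0)/(_ _)/wrap[|//] x; rewrite hornerN oppr_ge0.
exists S; split => //; first by apply/eqP; rewrite eqn_leq Sn.
move=> x; apply/idP/idP => [/(allP rS)//|rx]; apply/negPn/negP => xS.
have := @max_poly_roots _ _ (x :: S) Hn0.
by rewrite /= rx rS xS uS size_H ltnS ltnNge nS => /(_ isT isT).
Qed.

(** * Polynomials times exponentials of polynomials *)

Section PolyExp.
Variable R : realType.
Implicit Types P S : {poly R}.

Definition polyexp P S (x : R) : R := P.[x] * expR S.[x].

Global Instance is_derive_polyexp P S (x : R) :
  is_derive x 1 (polyexp P S) (polyexp (P^`() + P * S^`()) S x).
Proof.
have h1 := is_derive1_comp (is_derive_expR S.[x]) (is_derive_poly S x).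
apply: is_derive_eq (is_deriveM (is_derive_poly P x) h1) _.
by rewrite /polyexp hornerD hornerM /= /GRing.scale /=; ring.
Qed.

Lemma derivable_polyexp P S x : derivable (polyexp P S) x 1.
Proof. by have [] := is_derive_polyexp P S x. Qed.

Lemma derive1_polyexp P S x :
  derive1 (polyexp P S) x = polyexp (P^`() + P * S^`()) S x.
Proof. by rewrite derive1E; apply: derive_val. Qed.

Lemma continuous_polyexp P S : continuous (polyexp P S).
Proof. by move=> x; apply/differentiable_continuous/derivable1_diffP/derivable_polyexp. Qed.

(** Gronwall's inequality: multiplied by [exp (Lam x)] the function increases,
    multiplied by [exp (- Lam x)] it decreases.  Both products are again of the
    form [polyexp], with another exponent. *)
Lemma gronwall_polyexp P S (Lam s t : R) : 0 < Lam ->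
  {in `[s, t], forall x, `|(P^`() + P * S^`()).[x]| <= Lam * P.[x]} ->
  {in `[s, t] &, forall x y,
    polyexp P S x <= expR (Lam * (t - s)) * polyexp P S y}.
Proof.
move=> L0 PL x y xst yst.
have st : s <= t by move: xst; rewrite in_itv /= => /andP[/le_trans]; apply.
have Py0 : 0 <= polyexp P S y.
  by rewrite mulr_ge0 ?expR_ge0// -(pmulr_rge0 _ L0) (le_trans _ (PL _ yst)).
have shift (k z : R) : polyexp P (S + k *: 'X) z = expR (k * z) * polyexp P S z.
  by rewrite /polyexp hornerD hornerZ hornerX expRD; ring.
have dshift (k z : R) : (P^`() + P * (S + k *: 'X)^`()).[z] =
    (P^`() + P * S^`()).[z] + k * P.[z].
  by rewrite !(derivD, derivZ, derivX) !(hornerD, hornerM, hornerZ, hornerC); ring.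
have sub z : z \in `]s, t[ -> z \in `[s, t] by apply: subset_itvW.
have [xy|yx] := leP x y.
  have : polyexp P (S + Lam *: 'X) x <= polyexp P (S + Lam *: 'X) y.
    apply: (@ger0_derive1_le_cc _ (polyexp P (S + Lam *: 'X)) s t) => //.
    - move=> z /sub zst; rewrite derive1_polyexp mulr_ge0 ?expR_ge0//.
      by have := PL _ zst; rewrite dshift ler_norml => /andP[+ _]; lra.
    - by apply: continuous_subspaceT => z; exact: continuous_polyexp.
  rewrite !shift -ler_pdivlMl ?expR_gt0// => /le_trans; apply.
  rewrite mulrA -expRN -expRD ler_wpM2r// ler_expR.
  move: xst yst; rewrite !in_itv /= => /andP[sx _] /andP[_ yt].
  by rewrite -mulrN -mulrDr ler_wpM2l ?(ltW L0)//; lra.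
have : polyexp P (S - Lam *: 'X) x <= polyexp P (S - Lam *: 'X) y.
  apply: (@ler0_derive1_le_cc _ (polyexp P (S - Lam *: 'X)) s t) => //.
  - move=> z /sub zst; rewrite derive1_polyexp mulr_le0_ge0 ?expR_ge0//.
    by have := PL _ zst; rewrite -scaleNr dshift ler_norml => /andP[_]; lra.
  - by apply: continuous_subspaceT => z; exact: continuous_polyexp.
  - exact: ltW.
rewrite -scaleNr !shift -ler_pdivlMl ?expR_gt0// => /le_trans; apply.
rewrite mulrA -expRN -expRD ler_wpM2r// ler_expR.
move: xst yst; rewrite !in_itv /= => /andP[_ xt] /andP[sy _].
by rewrite !mulNr opprK -mulrBr ler_wpM2l ?(ltW L0)//; lra.
Qed.

End PolyExp.

(** * Integration against an exponential weight *)

Section Integrals.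
Variable R : realType.
Local Notation mu := (@lebesgue_measure R).

Lemma cvg_seq_unique (u : nat -> R) (k l : R) :
  u n @[n --> \oo] --> k -> u n @[n --> \oo] --> l -> k = l.
Proof. by move=> uk ul; apply: (cvg_unique _ uk ul); exact: norm_hausdorff. Qed.

Lemma cvg_integral_symitv (f : R -> R) : mu.-integrable setT (EFin \o f) ->
  (\int[mu]_(x in `[- (n%:R : R), n%:R]) f x)%R @[n --> \oo] -->
  (\int[mu]_x f x)%R.
Proof.
move=> intf; pose F (n : nat) : R -> \bar R := EFin \o (f \_ `[- (n%:R : R), n%:R]).
have [mf _] := integrableP _ _ _ intf.
have E : (\int[mu]_x (f x)%:E)%E = (\int[mu]_x f x)%:E.
  by rewrite -[LHS]fineK// integrable_fin_num.
have h : (\int[mu]_x F n x)%E @[n --> \oo] --> (\int[mu]_x f x)%:E.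
  rewrite -E; apply: (@dominated_cvg _ _ _ mu setT measurableT F (EFin \o f)
    (abse \o (EFin \o f))).
  - move=> n; apply/measurable_EFinP/(measurable_restrictT _ _).1 => //.
    by apply: measurable_funTS; exact/measurable_EFinP.
  - move=> x _; apply: cvg_near_cst; near=> n.
    rewrite /F /= patchE; case: ifPn => //; rewrite notin_setE /=; case.
    rewrite in_itv /= -ler_norml; near: n; exact: nbhs_infty_ger.
  - by [].
  - by apply: integrable_abse.
  - by move=> n x _; rewrite /F /= lee_fin patchE; case: ifPn => // _; rewrite normr0.
apply: cvg_trans (fine_cvg h); apply: near_eq_cvg; near=> n => /=.
by rewrite [RHS]Rintegral_mkcond.
Unshelve. all: by end_near. Qed.

End Integrals.

(** The condition [c_ge2] serves to dominate the weight by a Gaussian. *)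
Section WeightIntegral.
Variables (R : realType) (a : nat) (c : R).
Hypothesis a_gt1 : (1 < a)%N.
Hypothesis a_even : ~~ odd a.
Hypothesis c_ge2 : 2 <= c.
Local Notation mu := (@lebesgue_measure R).
Implicit Types P Q : {poly R}.

Definition expo : {poly R} := - c *: 'X^a.

Lemma poly_le_expR P : exists2 K : R, 0 <= K &
  forall x : R, `|P.[x]| <= K * expR (x ^+ 2).
Proof.
exists (\sum_(i < size P) `|P`_i| * (i`!%:R * expR 1)).
  by apply: sumr_ge0 => i _; rewrite !mulr_ge0// ?ler0n// expR_ge0.
move=> x; rewrite horner_coef mulr_suml (le_trans (ler_norm_sum _ _ _))//.
apply: ler_sum => i _; rewrite normrM normrX -!mulrA ler_wpM2l//.
have y0 : 0 <= 1 + x ^+ 2 by rewrite addr_ge0// sqr_ge0.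
have xy : `|x| <= 1 + x ^+ 2.
  rewrite -[x ^+ 2]real_normK ?num_real//.
  by have := sqr_ge0 (`|x| - 1 / 2); rewrite sqrrB; lra.
rewrite (@le_trans _ _ ((1 + x ^+ 2) ^+ i))// ?lerXn2r// ?nnegrE//.
rewrite -expRD mulrC -ler_pdivrMr ?ltr0n ?fact_gt0//.
case: (nat_of_ord i) => [|j]; first by rewrite expr0 divr1 -[leLHS]expR0 ler_expR.
by rewrite (le_trans _ (expR_ge1Dxn j y0))// lerDr.
Qed.

(** [x ^+ a] is at least [x ^+ 2 - 1]. *)
Lemma expo_le (x : R) : expo.[x] <= c - 2 * x ^+ 2.
Proof.
rewrite hornerZ hornerXn mulNr -(odd_double_half a) (negPf a_even) add0n.
rewrite -muln2 mulnC exprM; have := sqr_ge0 x; move: (x ^+ 2) => y y0.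
have yj : y - 1 <= y ^+ a./2.
  have a2 : (0 < a./2)%N by rewrite half_gt0.
  have [y1|/ltW y1] := leP y 1; first by rewrite (@le_trans _ _ 0) ?subr_le0// exprn_ge0.
  by rewrite (@le_trans _ _ y) ?gerBl// -{1}[y]expr1 ler_weXn2l.
have : c * (y - 1) <= c * y ^+ a./2 by rewrite ler_wpM2l// (le_trans _ c_ge2).
have : 2 * y <= c * y by rewrite ler_wpM2r.
lra.
Qed.

Lemma polyexp_le_gauss P : exists2 K : R, 0 <= K &
  forall x : R, `|polyexp P expo x| <= K * gauss_fun x.
Proof.
have [K K0 PK] := poly_le_expR P.
exists (K * expR c); first by rewrite mulr_ge0// expR_ge0.
move=> x; rewrite normrM (ger0_norm (expR_ge0 _)).
rewrite (le_trans (ler_wpM2r (expR_ge0 _) (PK x)))// -!mulrA ler_wpM2l//.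
by rewrite /gauss_fun -!expRD ler_expR; have := expo_le x; lra.
Qed.

Lemma measurable_polyexp P Q : measurable_fun [set: R] (polyexp P Q).
Proof. by apply: continuous_measurable_fun => x; exact: continuous_polyexp. Qed.

Lemma integrable_polyexp P : mu.-integrable setT (EFin \o polyexp P expo).
Proof.
have [K K0 PK] := polyexp_le_gauss P.
apply: (@le_integrable _ _ R mu setT measurableT _ (fun x : R => (K%:E * (gauss_fun x)%:E)%E)).
- by apply/measurable_EFinP; exact: measurable_polyexp.
- move=> x _ /=; rewrite lee_fin [`|K * _|]normrM (ger0_norm K0).
  by rewrite (ger0_norm (gauss_fun_ge0 _)).
- exact: integrableZl (@integrableT_gauss R).
Qed.

Lemma cvg_polyexp0 P : polyexp P expo n%:R @[n --> \oo] --> (0 : R).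
Proof.
have [K K0 PK] := polyexp_le_gauss P.
have g0 : K * gauss_fun (n%:R : R) @[n --> \oo] --> K * (0 : R).
  apply: cvgMr; apply: cvg_comp; last exact: cvg_gauss_fun.
  exact: cvgr_idn.
rewrite mulr0 in g0; apply: norm_cvg0; apply: (squeeze_cvgr _ (cvg_cst 0) g0).
by near=> n; rewrite normr_ge0 PK.
Unshelve. all: by end_near. Qed.

Definition wint P : R := (\int[mu]_x polyexp P expo x)%R.

Lemma wint_is_linear k : forall P Q, wint (k *: P + Q) = k * wint P + wint Q.
Proof.
move=> P Q; rewrite /wint -RintegralZl//; last exact: integrable_polyexp.
rewrite -RintegralD//; last exact: integrable_polyexp.
  by apply: eq_Rintegral => x _; rewrite /polyexp hornerD hornerZ; ring.
have := integrable_polyexp (k *: P); apply: eq_integrable => // x _ /=.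
by rewrite /polyexp hornerZ mulrA.
Qed.

Lemma wint_even P : wint (P \Po - 'X) = wint P.
Proof.
have h1 := cvg_integral_symitv (integrable_polyexp P).
have h2 := cvg_integral_symitv (integrable_polyexp (P \Po - 'X)).
apply: cvg_seq_unique h2 _; apply: cvg_trans h1; apply: near_eq_cvg; near=> n.
rewrite /Rintegral; congr fine.
have := @integration_by_substitution_oppr R (polyexp P expo) (- n%:R) n%:R.
rewrite opprK => ->.
- apply: eq_integral => x _; congr (_%:E); rewrite /= /polyexp.
  rewrite horner_comp !(hornerN, hornerX, hornerZ, hornerXn).
  by rewrite exprNn -signr_odd (negPf a_even) mul1r.
- by rewrite (@le_trans _ _ 0)// oppr_le0.
- by apply: continuous_subspaceT => z; exact: continuous_polyexp.
Unshelve. all: by end_near. Qed.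

Lemma wint_deriv P : wint (P^`() + P * expo^`()) = 0.
Proof.
have h1 := cvg_integral_symitv (integrable_polyexp (P^`() + P * expo^`())).
have h2 : polyexp P expo n%:R - polyexp (P \Po - 'X) expo n%:R @[n --> \oo] -->
    (0 - 0 : R) by apply: cvgB; exact: cvg_polyexp0.
rewrite subrr in h2; apply: cvg_seq_unique h1 _; apply: cvg_trans h2.
apply: near_eq_cvg; near=> n.
have n0 : (0 : R) < n%:R by rewrite ltr0n; near: n; exact: nbhs_infty_gt.
rewrite /Rintegral (@continuous_FTC2 _ _ (polyexp P expo)).
- rewrite /= /polyexp horner_comp !(hornerN, hornerX, hornerZ, hornerXn).
  by rewrite exprNn -signr_odd (negPf a_even) mul1r.
- lra.
- by apply: continuous_subspaceT => z; exact: continuous_polyexp.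
- split; first by move=> x _; exact: derivable_polyexp.
    by apply: cvg_at_right_filter; exact: continuous_polyexp.
  by apply: cvg_at_left_filter; exact: continuous_polyexp.
- by move=> x _; exact: derive1_polyexp.
Unshelve. all: by end_near. Qed.

Lemma wint_ge0 P : (forall x, 0 <= P.[x]) -> 0 <= wint P.
Proof. by move=> P0; apply: Rintegral_ge0 => x _; rewrite mulr_ge0 ?expR_ge0. Qed.

End WeightIntegral.

(** * Pointwise decay of the orthonormal functions *)

Section Average.
Variable R : realType.
Local Notation mu := (@lebesgue_measure R).

Lemma interval_average (f : R -> R) (s t A : R) : s <= t -> 0 <= A ->
  mu.-integrable setT (EFin \o f) -> (forall x, 0 <= f x) ->
  {in `[s, t], forall x, A <= f x} -> (t - s) * A <= (\int[mu]_x f x)%R.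
Proof.
move=> st A0 intf f0 Af; have [mf _] := integrableP _ _ _ intf.
have mI : measurable (`[s, t] : set (measurableTypeR R)) by exact: measurable_itv.
rewrite -lee_fin (_ : (\int[mu]_x f x)%R%:E = \int[mu]_x (f x)%:E)%E; last first.
  by rewrite /Rintegral fineK// integrable_fin_num.
apply: (@le_trans _ _ (\int[mu]_(x in `[s, t]) (f x)%:E)%E); last first.
  by apply: ge0_subset_integral => // x _; rewrite lee_fin.
have -> : ((t - s) * A)%:E = (\int[mu]_(x in `[s, t]) (A%:E))%E.
  rewrite integral_cst//= lebesgue_measure_itv /= lte_fin.
  case: ltP => [_|ts]; first by rewrite -EFinD -EFinM mulrC.
  by rewrite (@le_anti _ _ t s) ?ts// subrr mul0r mule0.
apply: ge0_le_integral => //; first exact: measurable_funTS.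
Qed.

End Average.

Section Freud.
Variables (R : realType) (a : nat) (c : R).
Hypothesis a_gt1 : (1 < a)%N.
Hypothesis a_even : ~~ odd a.
Hypothesis c_ge2 : 2 <= c.
Local Notation mu := (@lebesgue_measure R).
Local Notation wint := (wint a c).
Local Notation expo := (expo a c).

Lemma poly_neq0_horner (P : {poly R}) : P != 0 -> exists x, P.[x] != 0.
Proof.
move=> P0; apply: contrapT => h.
pose r : seq R := [seq i%:R | i <- iota 0 (size P)].
have rt : all (root P) r.
  by apply/allP => x _; apply/rootP/eqP/negPn/negP => Px; apply: h; exists x.
have ur : uniq r.
  by rewrite map_inj_uniq ?iota_uniq// => i j /eqP; rewrite eqr_nat => /eqP.
by have := max_poly_roots P0 rt ur; rewrite size_map size_iota ltnn.
Qed.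

Lemma wint_gt0 (P : {poly R}) : P != 0 -> (forall x, 0 <= P.[x]) -> 0 < wint P.
Proof.
move=> /poly_neq0_horner[x Px] P0; set f := polyexp P expo.
have f0 y : 0 <= f y by rewrite mulr_ge0 ?expR_ge0.
have fx : 0 < f x by rewrite mulr_gt0 ?expR_gt0// lt0r Px P0.
have := @continuous_polyexp _ P expo x; move/cvgrPdist_lt => /(_ _ (divr_gt0 fx (ltr0n _ 2))).
move=> /nbhs_ballP[e /= e0 He].
have e20 : 0 < e / 2 by rewrite divr_gt0.
have := @interval_average _ f (x - e / 2) (x + e / 2) (f x / 2) _ _
  (integrable_polyexp a_gt1 a_even c_ge2 P) f0 _.
rewrite -/(wint P) => h; apply: lt_le_trans (h _ _ _).
- by rewrite mulr_gt0 ?divr_gt0//; lra.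
- lra.
- by rewrite divr_ge0.
move=> y; rewrite in_itv /= => /andP[y1 y2].
have /He : ball x e y by rewrite /ball /= ltr_norml; apply/andP; split; lra.
by rewrite -/f => /ltW; rewrite ler_norml => /andP[_]; lra.
Qed.

Lemma wint_scalar : exists L : {scalar {poly R}}, forall P, L P = wint P.
Proof.
have lin : linear_for *%R wint by exact: wint_is_linear.
pose LM := GRing.isLinear.Build R {poly R} R *%R wint lin.
pose L : {scalar {poly R}} := HB.pack wint LM.
by exists L.
Qed.

(** The weight of [L] is [exp (- c x ^ a)]. *)
Section Pointwise.
Variables (L : {scalar {poly R}}) (H : nat -> {poly R}).
Hypothesis LE : forall P, L P = wint P.
Hypothesis size_H : forall k, size (H k) = k.+1.
Hypothesis lead_H : forall k, 0 < lead_coef (H k).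
Hypothesis H_orthonormal : forall j k, L (H j * H k) = (j == k)%:R.

Let v : R := c * a%:R.

Lemma expo_deriv : expo^`() = - v *: 'X^(a.-1).
Proof. by rewrite derivZ derivXn -scaler_nat scalerA mulNr. Qed.

Lemma L_even (P : {poly R}) : L (P \Po - 'X) = L P.
Proof. by rewrite !LE wint_even. Qed.

Lemma L_ibp (P : {poly R}) : L P^`() = v * L ('X^(a.-1) * P).
Proof.
have := wint_deriv a_gt1 a_even c_ge2 P; rewrite -LE raddfD /= expo_deriv.
rewrite -scalerAr linearZ /= mulNr => /eqP; rewrite subr_eq0 => /eqP ->.
by rewrite [P * _]mulrC.
Qed.

Lemma L_gt0 (P : {poly R}) : P != 0 -> (forall x, 0 <= P.[x]) -> 0 < L P.
Proof. by rewrite LE; exact: wint_gt0. Qed.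

Definition kappa k : R := k%:R `^ a%:R^-1.

Lemma kappa_ge0 k : 0 <= kappa k. Proof. exact: powR_ge0. Qed.

Lemma kappaX k : kappa k ^+ a = k%:R.
Proof.
rewrite -powR_mulrn ?kappa_ge0// -powRrM mulVf ?powRr1//.
by rewrite pnatr_eq0 -lt0n ltnW.
Qed.

Let v_ge1 : 1 <= v.
Proof.
have : 1 <= a%:R :> R by rewrite ler1n ltnW.
by have := c_ge2; rewrite /v; nra.
Qed.

Lemma wint_energy k : wint (energy H k) = 2.
Proof. by rewrite -LE raddfD /= !expr2 !H_orthonormal !eqxx. Qed.

Lemma energy_ge0 k x : 0 <= (energy H k).[x].
Proof. by rewrite /energy hornerD !horner_exp addr_ge0// sqr_ge0. Qed.

(** By Gronwall's inequality [P] times the weight is constant up to a factor on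
    the interval, so that its value at [x] is controlled by its mean, hence by
    the total integral of the energy, which is 2. *)
Lemma energy_from_growth k (P : {poly R}) (Lam s t m M : R) :
  0 < m -> 0 < M -> s < t -> 0 < Lam ->
  {in `[s, t], forall x, [/\ m * (energy H k).[x] <= P.[x],
     P.[x] <= M * (energy H k).[x] &
     `|(P^`() + P * expo^`()).[x]| <= Lam * P.[x]]} ->
  {in `[s, t], forall x, (t - s) * (m * polyexp (energy H k) expo x) <=
     2 * (expR (Lam * (t - s)) * M)}.
Proof.
move=> m0 M0 st L0 HP x xst; set e := expR _.
have e0 : 0 < e by rewrite expR_gt0.
set F := polyexp (energy H k) expo.
have F0 y : 0 <= F y by rewrite mulr_ge0 ?energy_ge0 ?expR_ge0.
have FP y : y \in `[s, t] -> m * F x <= e * (M * F y).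
  move=> yst; have [_ _ gr] := all_and3 (fun z => all_and3 (HP z)).
  have := gronwall_polyexp L0 gr xst yst; rewrite -/e.
  have [mx _ _] := HP _ xst; have [_ My _] := HP _ yst.
  rewrite /F /polyexp => h; apply: le_trans (le_trans _ h) _.
    by rewrite mulrA ler_wpM2r ?expR_ge0.
  by rewrite ler_pM2l// mulrA ler_wpM2r ?expR_ge0.
have := @interval_average _ F s t (m * F x / (e * M)) (ltW st) _
   (integrable_polyexp a_gt1 a_even c_ge2 _) F0 _.
rewrite -/(wint _) wint_energy => h.
rewrite -ler_pdivrMr ?mulr_gt0// -mulrA; apply: h.
  by rewrite divr_ge0 ?(mulr_ge0 (ltW m0))// (mulr_ge0 (ltW e0) (ltW M0)).
by move=> y yst; rewrite ler_pdivrMr ?mulr_gt0// [F y * _]mulrC -mulrA FP.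
Qed.

(** Within the range of [hamiltonian_bounds] the interval is the whole range.
    Beyond it [|x|] exceeds a multiple of [kappa k], and the interval from [x]
    has length the inverse of the growth rate of the energy, a power of [|x|];
    this loses a factor that powers of [|x|] absorb. *)
Lemma energy_pointwise : exists2 C : R, 0 < C & forall k (x : R), (0 < k)%N ->
  kappa k * polyexp (energy H k) expo x <= C * (1 + `|x|) ^+ a.
Proof.
have a_gt0 : (0 < a)%N by exact: ltnW.
have [cc [m [M [Lam [c0 m0 M0 L0 Hb]]]]] := hamiltonian_bounds size_H lead_H
  H_orthonormal L_even L_ibp a_gt1 a_even v_ge1 kappa_ge0 kappaX.
have [K K0 Hg] := energy_bound size_H lead_H H_orthonormal
  L_even L_ibp a_gt1 a_even v_ge1 kappa_ge0 kappaX.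
pose C1 := 2 * (expR (Lam * (2 * cc)) * M) / (2 * cc * m).
(* Outside the range of [hamiltonian_bounds], [y1 * (1 + |x|)] exceeds both
   [kappa k] and [|z|] for all [z] between [x] and [x + 1]. *)
pose y1 := 1 + cc^-1.
pose C2 := 2 * expR 1 * ((K + 1) * y1 ^+ a.-1) / cc.
have y1_gt0 : 0 < y1 by rewrite addr_gt0// invr_gt0.
have C10 : 0 < C1 by rewrite divr_gt0 ?mulr_gt0 ?expR_gt0// mulr_gt0.
have C20 : 0 < C2 by rewrite !mulr_gt0 ?expR_gt0 ?exprn_gt0 ?invr_gt0 ?(addr_gt0 K0 ltr01).
exists (C1 + C2); first by rewrite addr_gt0.
move=> k x k0; have kp1 := kappa_ge1 a_gt1 kappa_ge0 kappaX k0.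
have kp0 : 0 < kappa k by rewrite (lt_le_trans ltr01).
set E := polyexp _ _ x.
have E0 : 0 <= E by rewrite mulr_ge0 ?energy_ge0 ?expR_ge0.
have x1 : 1 <= 1 + `|x| by rewrite lerDl.
have xa1 : 1 <= (1 + `|x|) ^+ a by rewrite exprn_ege1.
have eqd (P : {poly R}) z :
    (P^`() + P * expo^`()).[z] = P^`().[z] - v * z ^+ a.-1 * P.[z].
  by rewrite expo_deriv hornerD hornerM hornerZ hornerXn; ring.
have [xk|kx] := leP `|x| (cc * kappa k).
  have Y0 : 0 < kappa k ^+ a.-1 by rewrite exprn_gt0.
  have mY := mulr_gt0 m0 Y0; have MY := mulr_gt0 M0 Y0.
  have st : - (cc * kappa k) < cc * kappa k by rewrite gtrN// mulr_gt0.
  have LK : 0 < Lam / kappa k by rewrite divr_gt0.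
  have growth : {in `[- (cc * kappa k), cc * kappa k], forall z : R,
      [/\ m * kappa k ^+ a.-1 * (energy H k).[z] <= (hamiltonian L H v a k).[z],
          (hamiltonian L H v a k).[z] <= M * kappa k ^+ a.-1 * (energy H k).[z] &
      `|((hamiltonian L H v a k)^`() + (hamiltonian L H v a k) * expo^`()).[z]| <=
        Lam / kappa k * (hamiltonian L H v a k).[z]]}.
    move=> z; rewrite in_itv /= -ler_norml => zk.
    have [h1 h2 h3] := Hb k z k0 zk; split=> //.
    by rewrite eqd [Lam / _ * _]mulrAC ler_pdivlMr.
  have xs : x \in `[- (cc * kappa k), cc * kappa k] by rewrite in_itv /= -ler_norml.
  have := energy_from_growth mY MY st LK growth xs.
  rewrite -/E opprK (_ : Lam / _ * _ = Lam * (2 * cc)); last first.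
    by field; rewrite gt_eqF.
  have -> : (cc * kappa k + cc * kappa k) * (m * kappa k ^+ a.-1 * E) =
    (2 * cc * m * kappa k ^+ a.-1) * (kappa k * E) by ring.
  rewrite -ler_pdivlMl ?mulr_gt0// => h.
  apply: le_trans h _; rewrite [leLHS](_ : _ = C1); last first.
    by rewrite /C1; field; rewrite !gt_eqF.
  by rewrite (@le_trans _ _ (C1 + C2)) ?lerDl ?ler_peMr// ltW// addr_gt0.
set y := y1 * (1 + `|x|).
have y_ge1 : 1 <= y by rewrite -[1]mulr1 ler_pM// lerDl invr_ge0 ltW.
have ky : kappa k <= y.
  rewrite (@le_trans _ _ (cc^-1 * `|x|))//; first by rewrite ler_pdivlMl ?ltW.
  by rewrite ler_pM ?invr_ge0 ?(ltW c0)// ?lerDr// ler_wpDl.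
have xy z : z \in `[x, x + 1] -> `|z| <= y.
  rewrite in_itv /= => /andP[xz zx]; rewrite (@le_trans _ _ (1 + `|x|))//.
    rewrite ler_norml; have := ler_norm x; have := lerNnormlW (lexx `|x|).
    lra.
  by rewrite ler_peMl ?addr_ge0// lerDl invr_ge0 ltW.
set Y := y ^+ a.-1; have Y1 : 1 <= Y by rewrite exprn_ege1.
set Lm := (K + 1) * Y.
have Lm1 : 1 <= Lm by rewrite -[1]mulr1 ler_pM// lerDr ltW.
have Lm0 : 0 < Lm by rewrite (lt_le_trans ltr01).
have Lmi : Lm^-1 <= 1 by rewrite invf_le1.
have := @energy_from_growth k (energy H k) Lm x (x + Lm^-1) 1 1 ltr01 ltr01 _ Lm0
  _ x _.
rewrite ltrDl invr_gt0 Lm0 addrAC subrr add0r mul1r mulfV ?gt_eqF// mulr1 -/E => h.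
have {h} : Lm^-1 * E <= 2 * expR 1.
  apply: h => //; last by rewrite in_itv /= lexx lerDl invr_ge0 ltW.
  move=> z; rewrite in_itv /= => /andP[xz zx]; rewrite !mul1r; split => //.
  rewrite eqd (le_trans (Hg k z y k0 ky _))//.
    by apply: xy; rewrite in_itv /= xz (le_trans zx)// lerD2l.
  by rewrite ler_wpM2r ?energy_ge0// ler_wpM2r ?(le_trans ler01)// lerDl.
rewrite ler_pdivrMl// => hE.
have kx' : kappa k <= (1 + `|x|) / cc.
  by rewrite ler_pdivlMr// mulrC (le_trans (ltW kx))// lerDr.
apply: (@le_trans _ _ (((1 + `|x|) / cc) * (Lm * (2 * expR 1)))).
  by rewrite ler_pM// ltW.
rewrite [leLHS](_ : _ = C2 * (1 + `|x|) ^+ a).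
  by rewrite ler_wpM2r ?(le_trans ler01)// lerDr ltW.
have -> : (1 + `|x|) ^+ a = (1 + `|x|) * (1 + `|x|) ^+ a.-1.
  by rewrite -exprS prednK.
rewrite /C2 /Lm /Y /y exprMn.
by field; rewrite gt_eqF.
Qed.

End Pointwise.
End Freud.

(** * Sums over the quadrature nodes *)

Lemma cauchy_schwarz_sum (R : realFieldType) (I : Type) (r : seq I)
    (w u v : I -> R) :
  (forall i, 0 <= w i) ->
  (\sum_(i <- r) w i * (u i * v i)) ^+ 2 <=
  (\sum_(i <- r) w i * u i ^+ 2) * (\sum_(i <- r) w i * v i ^+ 2).
Proof.
move=> w0; set S := (X in X ^+ 2 <= _); set A := (X in _ <= X * _).
set B := (X in _ <= _ * X).
have A0 : 0 <= A by apply: sumr_ge0 => i _; rewrite mulr_ge0 ?sqr_ge0.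
have key t : 0 <= A * t ^+ 2 - 2 * S * t + B.
  rewrite (_ : _ + _ = \sum_(i <- r) w i * (t * u i - v i) ^+ 2); last first.
    rewrite /A /S /B mulr_sumr !mulr_suml -sumrB -big_split /=.
    by apply: eq_bigr => i _; ring.
  by apply: sumr_ge0 => i _; rewrite mulr_ge0 ?sqr_ge0.
move: A0; rewrite le_eqVlt => /predU1P[A0|A0].
  (* The quadratic is then affine in [t], with value -1 at [(B + 1) / (2 * S)]. *)
  rewrite -A0 mul0r; have [->|S0] := eqVneq S 0; first by rewrite expr0n.
  have := key ((B + 1) / (2 * S)); rewrite -A0 mul0r sub0r.
  rewrite (_ : 2 * S * _ = B + 1); first by lra.
  by field; rewrite S0.
have := key (S / A); rewrite (_ : _ + _ = (A * B - S ^+ 2) / A); last first.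
  by field; rewrite gt_eqF.
by rewrite pmulr_lge0 ?invr_gt0// subr_ge0.
Qed.

Lemma cvg_sum_seq (R : realType) (I : Type) (r : seq I) (u : I -> nat -> R)
    (l : I -> R) :
  (forall i, u i n @[n --> \oo] --> l i) ->
  (\sum_(i <- r) u i n) @[n --> \oo] --> \sum_(i <- r) l i.
Proof.
move=> ul; elim: r => [|i r IH].
  under eq_cvg do rewrite big_nil; rewrite big_nil; exact: cvg_cst.
by under eq_cvg do rewrite big_cons; rewrite big_cons; apply: cvgD.
Qed.

Lemma cvg_series_bounded (R : realType) (u : nat -> R) (B : R) :
  (forall N, \sum_(0 <= k < N) `|u k| <= B) -> cvgn (series u).
Proof.
move=> uB; apply: normed_cvg.
have mono : nondecreasing_seq (fun N => \sum_(0 <= k < N) `|u k|).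
  by apply/nondecreasing_seqP => n; rewrite big_nat_recr//= lerDl.
apply: (nondecreasing_is_cvgn mono).
by exists B => _ [N _ <-]; exact: uB.
Qed.

(** Here [exp (- d x ^ a)], [d = c / 2], is the square root of the weight of
    [L]. *)
Section Weights.
Variables (R : realType) (a : nat) (c : R).
Hypothesis a_gt1 : (1 < a)%N.
Hypothesis a_even : ~~ odd a.
Hypothesis c_ge4 : 4 <= c.
Local Notation mu := (@lebesgue_measure R).
Variables (L : {scalar {poly R}}) (H : nat -> {poly R}).
Hypothesis LE : forall P, L P = wint a c P.
Hypothesis size_H : forall k, size (H k) = k.+1.
Hypothesis lead_H : forall k, 0 < lead_coef (H k).
Hypothesis H_orthonormal : forall j k, L (H j * H k) = (j == k)%:R.

Local Notation kappa := (kappa R a).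

Let c_ge2 : 2 <= c. Proof. by move: c_ge4; lra. Qed.
Let d := c / 2.
Let d_ge2 : 2 <= d. Proof. by move: c_ge4; rewrite /d; lra. Qed.
Let d_ge0 : 0 <= d. Proof. by move: d_ge2; lra. Qed.

Lemma even_pow_ge0 (x : R) : 0 <= x ^+ a.
Proof. by rewrite real_exprn_even_ge0 ?num_real. Qed.

Lemma even_pow_norm (x : R) : `|x| ^+ a = x ^+ a.
Proof. by rewrite -normrX ger0_norm ?even_pow_ge0. Qed.

Lemma pow_one_plus_le (x : R) : (1 + `|x|) ^+ a <= 2 ^+ a * (1 + x ^+ a).
Proof.
have [x1|x1] := leP `|x| 1.
  apply: (@le_trans _ _ (2 ^+ a)); first by rewrite lerXn2r ?nnegrE//; lra.
  by rewrite ler_peMr ?exprn_ge0// lerDl even_pow_ge0.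
apply: (@le_trans _ _ (2 ^+ a * x ^+ a)); last first.
  by rewrite ler_wpM2l ?exprn_ge0// lerDr.
by rewrite -(even_pow_norm x) -exprMn lerXn2r ?nnegrE//; lra.
Qed.

Lemma expR_partial_le (N : nat) (y : R) : 0 <= y ->
  series (exp_coeff y) N <= expR y.
Proof.
move=> y0; apply: (nondecreasing_cvgn_le _ (is_cvg_series_exp_coeff y)).
by apply/nondecreasing_seqP => n; rewrite seriesSr lerDl exp_coeff_ge0.
Qed.

(** [(1 + x^a)] times a partial sum of the power series of
    [exp (d x ^ a)]. *)
Definition trunc_inv_weight N : {poly R} :=
  (1 + 'X^a) * \sum_(j < N) (d ^+ j / j`!%:R) *: 'X^(a * j).

Lemma trunc_inv_weightE N x :
  (trunc_inv_weight N).[x] = (1 + x ^+ a) * series (exp_coeff (d * x ^+ a)) N.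
Proof.
rewrite hornerM hornerD hornerXn hornerC horner_sum; congr (_ * _).
rewrite /series /= big_mkord; apply: eq_bigr => j _.
by rewrite hornerZ hornerXn exp_coeffE /= [(d * _) ^+ j]exprMn exprM mulrA [d ^+ j / _]mulrC.
Qed.

Lemma trunc_inv_weight_ge0 N i : 0 <= (trunc_inv_weight N)`_i.
Proof.
rewrite coefM; apply: sumr_ge0 => j _; apply: mulr_ge0.
  by rewrite coefD coef1 coefXn addr_ge0.
rewrite coef_sum; apply: sumr_ge0 => l _.
by rewrite coefZ coefXn mulr_ge0// divr_ge0 ?exprn_ge0.
Qed.

Lemma L_trunc_inv_weight N :
  L (trunc_inv_weight N) <= wint a d (1 + 'X^a).
Proof.
rewrite LE /wint; apply: le_Rintegral => //.
- exact: integrable_polyexp.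
- exact: integrable_polyexp.
move=> x _; rewrite /polyexp trunc_inv_weightE !(hornerZ, hornerD, hornerXn, hornerC).
rewrite -mulrA ler_wpM2l ?addr_ge0 ?even_pow_ge0//.
have yy : 0 <= d * x ^+ a by rewrite mulr_ge0 ?even_pow_ge0.
rewrite (le_trans (ler_wpM2r (expR_ge0 _) (expR_partial_le N yy)))//.
by rewrite -expRD ler_expR /d; lra.
Qed.

(** The Gauss sums of [trunc_inv_weight N] are at most its integrals, as its
    coefficients are nonnegative; these are bounded uniformly in [N]. *)
Lemma weights_bound : exists2 C : R, 0 < C & forall n (X : seq R), (0 < n)%N ->
  uniq X -> size X = n -> all (root (H n)) X ->
  \sum_(x <- X) cotes H n x * expR (d * x ^+ a) * (1 + `|x|) ^+ a <= C.
Proof.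
set M := wint a d (1 + 'X^a).
have M0 : 0 <= M.
  by apply: wint_ge0 => x; rewrite hornerD hornerXn hornerC addr_ge0 ?even_pow_ge0.
exists (2 ^+ a * M + 1); first by rewrite ltr_wpDl ?mulr_ge0 ?exprn_ge0.
move=> n X n0 uX sX rX.
have Le := L_even a_gt1 a_even c_ge2 LE; have co x := cotes_ge0 size_H lead_H n0 x.
have bnd N : \sum_(x <- X) cotes H n x * (trunc_inv_weight N).[x] <= M.
  apply: le_trans (L_trunc_inv_weight N).
  exact: (gauss_quad_le size_H lead_H H_orthonormal Le n0 uX sX rX (trunc_inv_weight_ge0 N)).
have lim : \sum_(x <- X) cotes H n x * ((1 + x ^+ a) * expR (d * x ^+ a)) <= M.
  have cv : (\sum_(x <- X) cotes H n x * (trunc_inv_weight N).[x]) @[N --> \oo] -->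
      \sum_(x <- X) cotes H n x * ((1 + x ^+ a) * expR (d * x ^+ a)).
    apply: cvg_sum_seq => x; apply: cvgMr.
    under eq_cvg do rewrite trunc_inv_weightE.
    by apply: cvgMr; exact: is_cvg_series_exp_coeff.
  rewrite -(cvg_lim _ cv)//; apply: limr_le; first by apply/cvg_ex; eexists; exact: cv.
  by near=> N; exact: bnd.
rewrite (@le_trans _ _ (2 ^+ a * M)) ?lerDl//.
apply: le_trans (ler_wpM2l (exprn_ge0 a (ler0n _ 2)) lim).
rewrite mulr_sumr; apply: ler_sum => x _; rewrite -mulrA [leRHS]mulrCA ler_wpM2l//.
rewrite [leLHS]mulrC [leRHS]mulrA ler_wpM2r ?expR_ge0//; exact: pow_one_plus_le.
Unshelve. all: by end_near. Qed.

Let h k (x : R) := (H k).[x] * expR (- (d * x ^+ a)).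
Let om n (x : R) := cotes H n x * expR (d * x ^+ a).

Lemma kappa_gt0 k : (0 < k)%N -> 0 < kappa k.
Proof.
move=> k0; have := kappa_ge1 a_gt1 (@kappa_ge0 R a) (@kappaX R a a_gt1) k0.
exact: lt_le_trans.
Qed.

Lemma h_sqr_decay : exists2 C : R, 0 < C & forall k x, (0 < k)%N ->
  h k x ^+ 2 <= C * (1 + `|x|) ^+ a / kappa k.
Proof.
have [C C0 p2] := energy_pointwise a_gt1 a_even c_ge2 LE size_H lead_H H_orthonormal.
exists C => // k x k0; rewrite ler_pdivlMr ?kappa_gt0// mulrC.
apply: le_trans (p2 k x k0); rewrite ler_wpM2l ?(ltW (kappa_gt0 k0))//.
rewrite /h /polyexp /energy exprMn -expRM_natl hornerD !horner_exp hornerZ hornerXn.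
rewrite (_ : expR (2 * _) = expR (- c * x ^+ a)); last by congr expR; rewrite /d; lra.
by rewrite ler_wpM2r ?expR_ge0// lerDl sqr_ge0.
Qed.

Lemma om_h n k x : om n x * h k x = cotes H n x * (H k).[x].
Proof.
rewrite /om /h expRN -mulrA; congr (_ * _).
by rewrite mulrCA mulfV ?mulr1// gt_eqF// expR_gt0.
Qed.

Lemma gauss_H_decay : exists2 C : R, 0 < C & forall n (X : seq R) k,
  (0 < n)%N -> uniq X -> size X = n -> all (root (H n)) X -> (0 < k)%N ->
  gauss_quad H n X (H k) ^+ 2 <= C / kappa k.
Proof.
have [C1 C10 w1] := weights_bound; have [C2 C20 hC] := h_sqr_decay.
exists (C1 * (C2 * C1)); first by rewrite !mulr_gt0.
move=> n X k n0 uX sX rX k0; have Wb := w1 n X n0 uX sX rX.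
have kp0 := kappa_gt0 k0.
have om0 x : 0 <= om n x.
  by rewrite mulr_ge0 ?expR_ge0 ?(cotes_ge0 size_H lead_H n0).
have -> : gauss_quad H n X (H k) = \sum_(x <- X) om n x * (1 * h k x).
  by apply: eq_bigr => x _; rewrite mul1r om_h.
apply: le_trans (cauchy_schwarz_sum _ _ _ om0) _.
rewrite ler_pdivlMr// -mulrA; apply: ler_pM.
- by apply: sumr_ge0 => x _; rewrite expr1n mulr1.
- rewrite mulr_ge0 ?(ltW kp0)//; apply: sumr_ge0 => x _.
  by rewrite mulr_ge0 ?sqr_ge0.
- apply: le_trans Wb; apply: ler_sum => x _; rewrite expr1n ler_wpM2l ?om0//.
  by rewrite exprn_ege1// lerDl.
apply: le_trans (ler_wpM2l (ltW C20) Wb); rewrite mulr_suml mulr_sumr.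
apply: ler_sum => x _; rewrite -/(om n x) [leRHS]mulrCA -[leLHS]mulrA.
by rewrite ler_wpM2l// -ler_pdivlMr// hC.
Qed.

(** ** The error in terms of the coefficients *)

Let L_parity := L_even a_gt1 a_even c_ge2 LE.

Lemma L_H k : L (H k) = (k == 0)%:R / lead_coef (H 0).
Proof.
have := lt0r_neq0 (lead_H 0); have := H0E size_H.
set l := lead_coef (H 0) => HE l0.
have -> : H k = l^-1 *: (H k * H 0).
  by rewrite [in RHS]HE mulrC mul_polyC scalerA mulVf// scale1r.
by rewrite linearZ /= H_orthonormal mulrC.
Qed.

(** The series defining the continuous representative converges: by
    Cauchy-Schwarz and [h_sqr_decay].  The sums on the weights start at index 2
    because this is [2n] for [n = 1]. *)
Lemma coef_series_cvg (w f : nat -> R) (A B x : R) : (forall k, 0 < w k) ->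
  (forall N, \sum_(0 <= k < N) w k * f k ^+ 2 <= A) ->
  (forall N, \sum_(2 <= k < N) (kappa k)^-1 / w k <= B) ->
  cvgn (series (fun k => f k * h k x)).
Proof.
move=> w0 fA hB; have [C C0 hC] := h_sqr_decay.
set Cx := C * (1 + `|x|) ^+ a.
have Cx0 : 0 <= Cx by rewrite mulr_ge0 ?exprn_ge0 ?addr_ge0// ltW.
have q0 k : 0 <= h k x ^+ 2 / w k by rewrite divr_ge0 ?sqr_ge0// ltW.
apply: (@cvg_series_bounded _ _ (A + (\sum_(0 <= k < 2) h k x ^+ 2 / w k + Cx * B))).
move=> N; apply: (@le_trans _ _ (\sum_(0 <= k < N) (w k * f k ^+ 2 + h k x ^+ 2 / w k))).
  apply: ler_sum => k _; rewrite normrM -[f k ^+ 2]real_normK ?num_real//.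
  rewrite -[h k x ^+ 2]real_normK ?num_real//.
  move: (`|f k|) (`|h k x|) (normr_ge0 (f k)) (normr_ge0 (h k x)) => u v u0 v0.
  rewrite -subr_ge0 (_ : _ - _ = w k * ((u - v / w k) ^+ 2 + u * (v / w k))).
    by rewrite mulr_ge0 ?(ltW (w0 k))// addr_ge0 ?sqr_ge0// mulr_ge0// divr_ge0// ltW.
  by field; rewrite gt_eqF.
rewrite big_split lerD//=.
apply: (@le_trans _ _ (\sum_(0 <= k < N.+2) h k x ^+ 2 / w k)).
  rewrite [leRHS](big_cat_nat (leq0n N))//= ?lerDl ?sumr_ge0//.
  by rewrite -addn2 leq_addr.
rewrite (big_cat_nat (leq0n 2))//= lerD2l.
apply: (@le_trans _ _ (Cx * \sum_(2 <= k < N.+2) (kappa k)^-1 / w k)).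
  rewrite mulr_sumr; apply: ler_sum_nat => k /andP[k2 _].
  by rewrite mulrA ler_wpM2r ?invr_ge0 ?(ltW (w0 k))// hC// ltnW.
by rewrite ler_wpM2l.
Qed.

(** [f] lists the real or the imaginary parts of the coefficients of a function.
    Coefficient 0 carries the exact integral, those of index [1 <= k < 2n]
    contribute nothing by exactness, and Cauchy-Schwarz applies to the rest. *)
Lemma quadrature_error_real : exists2 C : R, 0 < C &
  forall (w f D : nat -> R) (A : R) n (X : seq R), (0 < n)%N ->
  uniq X -> size X = n -> all (root (H n)) X ->
  (forall k, 0 < w k) ->
  (forall N, \sum_(0 <= k < N) w k * f k ^+ 2 <= A) ->
  (forall m N, (0 < m)%N -> \sum_(m.*2 <= k < N) (kappa k)^-1 / w k <= D m) ->
  (f 0 / lead_coef (H 0) -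
     \sum_(x <- X) om n x * limn (series (fun k => f k * h k x))) ^+ 2 <=
  A * (C * D n).
Proof.
have [C C0 decay] := gauss_H_decay.
exists C => // w f D A n X n0 uX sX rX w0 fA hD.
have A0 : 0 <= A by have := fA 0; rewrite big_geq.
have cv x : cvgn (series (fun k => f k * h k x)).
  exact: (coef_series_cvg w0 fA (fun N => hD 1 N isT)).
pose g k := gauss_quad H n X (H k).
pose e N := f 0 / lead_coef (H 0) - \sum_(x <- X) om n x * series (fun k => f k * h k x) N.
have ecv : e N @[N --> \oo] --> f 0 / lead_coef (H 0) -
     \sum_(x <- X) om n x * limn (series (fun k => f k * h k x)).
  apply: cvgB; first exact: cvg_cst.
  by apply: cvg_sum_seq => x; apply: cvgMr; exact: cv.
have eE N : (n.*2 <= N)%N -> e N = - \sum_(n.*2 <= k < N) f k * g k.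
  move=> nN; rewrite /e.
  have -> : \sum_(x <- X) om n x * series (fun k => f k * h k x) N =
      \sum_(0 <= k < N) f k * g k.
    under eq_bigr => x _ do rewrite seriesEnat /= mulr_sumr.
    rewrite exchange_big /=; apply: eq_bigr => k _.
    rewrite /g /gauss_quad mulr_sumr; apply: eq_bigr => x _.
    by rewrite mulrCA om_h.
  rewrite (big_cat_nat (leq0n n.*2))//= big_ltn ?double_gt0// big1_seq ?addr0.
    rewrite /g (gauss_quad_H size_H lead_H H_orthonormal L_parity n0 uX sX rX n0).
    by rewrite L_H eqxx mul1r; ring.
  move=> k; rewrite mem_index_iota => /andP[_ /andP[k0 kn]].
  have szk : (size (H k) <= n.*2)%N by rewrite size_H.
  rewrite /g (gauss_quad_exact size_H lead_H H_orthonormal L_parity n0 uX sX rX szk).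
  by rewrite L_H (gtn_eqF k0) mul0r mulr0.
have e2 N : (n.*2 <= N)%N -> e N ^+ 2 <= A * (C * D n).
  move=> nN; rewrite eE// sqrrN.
  have -> : \sum_(n.*2 <= k < N) f k * g k =
      \sum_(n.*2 <= k < N) w k * (f k * (g k / w k)).
    by apply: eq_bigr => k _; field; rewrite gt_eqF.
  apply: le_trans (cauchy_schwarz_sum _ _ _ (fun k => ltW (w0 k))) _.
  apply: ler_pM.
  - by apply: sumr_ge0 => k _; rewrite mulr_ge0 ?sqr_ge0// ltW.
  - by apply: sumr_ge0 => k _; rewrite mulr_ge0 ?sqr_ge0// ltW.
  - apply: le_trans (fA N); rewrite [leRHS](big_cat_nat (leq0n n.*2))//= lerDr.
    by apply: sumr_ge0 => k _; rewrite mulr_ge0 ?sqr_ge0// ltW.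
  apply: le_trans (ler_wpM2l (ltW C0) (hD n N n0)); rewrite mulr_sumr.
  apply: ler_sum_nat => k /andP[nk _].
  have k0 : (0 < k)%N by rewrite (leq_trans _ nk)// double_gt0.
  rewrite [leLHS](_ : _ = g k ^+ 2 / w k); last by field; rewrite gt_eqF.
  by rewrite mulrA ler_wpM2r ?invr_ge0 ?(ltW (w0 k))// decay.
move: ecv; set E := (X in _ --> X); rewrite -/E => ecv.
have e2cv : (e N * e N) @[N --> \oo] --> E * E by exact: cvgM.
rewrite expr2 -(cvg_lim _ e2cv)//.
apply: limr_le; first by apply/cvg_ex; eexists; exact: e2cv.
near=> N; rewrite /= -expr2; apply: e2; near: N; exact: nbhs_infty_ge.
Unshelve. all: by end_near. Qed.

End Weights.

(** * Tails of series *)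

Section TailSums.
Variable R : realType.

Lemma telescoping_tail (u g : nat -> R) m N :
  (forall k, (m <= k)%N -> u k <= g k - g k.+1) -> (forall k, 0 <= g k) ->
  \sum_(m <= k < N) u k <= g m.
Proof.
move=> ug g0; have [mN|Nm] := leqP m N; last by rewrite big_geq// ltnW.
rewrite (@le_trans _ _ (\sum_(m <= k < N) (g k - g k.+1)))//.
  by apply: ler_sum_nat => k /andP[mk _]; exact: ug.
rewrite (_ : \sum_(m <= k < N) _ = - \sum_(m <= k < N) (g k.+1 - g k)).
  by rewrite telescope_sumr// opprB lerBlDr lerDl.
by rewrite -sumrN; apply: eq_bigr => k _; rewrite opprB.
Qed.

Lemma powRD_gt0 (x r t : R) : 0 < x -> x `^ (r + t) = x `^ r * x `^ t.
Proof. by move=> x0; rewrite powRD// (gt_eqF x0) implybT. Qed.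

(** Bernoulli's inequality, by averaging tangent bounds of the exponential at
    [p * ln x] with weights [p] and [1 - p]. *)
Lemma powR_le_linear (x p : R) : 0 < x -> 0 <= p <= 1 -> x `^ p <= 1 + p * (x - 1).
Proof.
move=> x0 /andP[p0 p1]; rewrite /powR gt_eqF//; set u := ln x.
have xE : x = expR u by rewrite /u lnK.
set z := expR (p * u); have z0 : 0 < z by exact: expR_gt0.
have h1 : z * (1 + (1 - p) * u) <= x.
  have uE : u = p * u + (1 - p) * u by ring.
  by rewrite xE [in leRHS]uE expRD ler_pM2l// expR_ge1Dx.
have h2 : z * (1 - p * u) <= 1.
  rewrite -[leRHS](mulfV (lt0r_neq0 z0)) ler_pM2l// -expRN.
  exact: expR_ge1Dx.
have : p * (z * (1 + (1 - p) * u)) <= p * x by rewrite ler_wpM2l.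
have : (1 - p) * (z * (1 - p * u)) <= (1 - p) * 1 by rewrite ler_wpM2l// subr_ge0.
lra.
Qed.

Lemma powR_ge_linear (x t : R) : 0 < x -> 0 <= t -> 1 + t * (1 - x^-1) <= x `^ t.
Proof.
move=> x0 t0; rewrite /powR gt_eqF//; apply: le_trans (expR_ge1Dx _).
rewrite lerD2l ler_wpM2l// -[ln x]opprK -lnV ?posrE//.
have xi : -1 < x^-1 - 1 by rewrite ltrBDr addNr invr_gt0.
by have := le_ln1Dx xi; rewrite addrC subrK; lra.
Qed.

Lemma tail_powR (t : R) : 1 < t -> exists2 C : R, 0 < C & forall m N, (0 < m)%N ->
  \sum_(m <= k < N) (k%:R `^ (- t) : R) <= C * m%:R `^ (1 - t).
Proof.
move=> t1; set T := t - 1; have T0 : 0 < T by rewrite subr_gt0.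
exists (2 `^ t / T); first by rewrite divr_gt0// powR_gt0.
move=> m N m0.
apply: (@telescoping_tail _ (fun k => 2 `^ t / T * k%:R `^ (1 - t))); last first.
  by move=> k; rewrite mulr_ge0 ?powR_ge0// divr_ge0 ?powR_ge0// ltW.
move=> k mk; have k0 : 0 < k%:R :> R by rewrite ltr0n (leq_trans m0).
have k10 : 0 < k.+1%:R :> R by [].
set K := k.+1%:R : R.
have kE : k%:R `^ (1 - t) = K `^ (1 - t) * (K / k%:R) `^ T.
  rewrite powRM ?invr_ge0 ?(ltW k0)// mulrA -powRD_gt0//.
  rewrite /T subrKA (_ : 1 - 1 = 0) ?subrr// powRr0 mul1r -[in RHS]powR_inv1 ?ltW//.
  by rewrite -powRrM; congr (_ `^ _); ring.
have h1 : K `^ (1 - t) * (1 + T / K) <= k%:R `^ (1 - t).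
  rewrite kE ler_wpM2l ?powR_ge0//.
  apply: le_trans (powR_ge_linear (divr_gt0 k10 k0) (ltW T0)).
  rewrite lerD2l ler_wpM2l ?(ltW T0)// invf_div.
  rewrite le_eqVlt; apply/orP; left; apply/eqP.
  have K1 : K = k%:R + 1 by rewrite /K -natr1.
  by rewrite -/K K1; field; rewrite -K1 gt_eqF.
have h2 : k%:R `^ (- t) <= 2 `^ t * (K `^ (1 - t) / K).
  rewrite -[K^-1]powR_inv1 ?(ltW k10)// -powRD_gt0//.
  rewrite (_ : 1 - t + -1 = - t); last by ring.
  rewrite !powRN ler_pdivlMr ?powR_gt0// mulrC ler_pdivrMr ?powR_gt0//.
  rewrite -powRM ?(ltW k0)//; apply: ge0_ler_powR; rewrite ?nnegrE ?mulr_ge0//.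
    by rewrite (le_trans ler01)// ltW.
  by rewrite /K -natr1 mulr_natl mulr2n lerD2l ler1n -(ltr0n R).
rewrite -mulrBr (le_trans h2)// -mulrA ler_wpM2l ?powR_ge0//.
rewrite ler_pdivlMl// mulrCA.
by move: h1; rewrite mulrDr mulr1 lerBrDl.
Qed.

Lemma tail_exp_ge1 (p q : R) : 1 <= p -> 0 < q -> exists2 C : R, 0 < C &
  forall m N, (0 < m)%N ->
  \sum_(m <= k < N) expR (- (q * k%:R `^ p)) <= C * expR (- (q * m%:R `^ p)).
Proof.
move=> p1 q0; have e1 : 0 < 1 - expR (- q) by rewrite subr_gt0 -expR0 ltr_expR oppr_lt0.
exists (1 - expR (- q))^-1; first by rewrite invr_gt0.
move=> m N m0.
apply: (@telescoping_tail _
  (fun k => (1 - expR (- q))^-1 * expR (- (q * k%:R `^ p)))); last first.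
  by move=> k; rewrite mulr_ge0 ?expR_ge0// invr_ge0 ltW.
move=> k mk; have k1 : 1 <= k%:R :> R by rewrite ler1n (leq_trans m0).
have k0 : 0 < k%:R :> R by rewrite (lt_le_trans ltr01).
have kp : k%:R `^ p + 1 <= k.+1%:R `^ p.
  have p0 := lt_le_trans ltr01 p1.
  rewrite -(mulr_powRB1 (ltW k0) p0) -(mulr_powRB1 (ler0n R k.+1) p0).
  have pp : 0 <= p - 1 by rewrite subr_ge0.
  have h1 : k%:R `^ (p - 1) <= k.+1%:R `^ (p - 1).
    by apply: ge0_ler_powR; rewrite ?nnegrE// ler_nat.
  have h2 : 1 <= k.+1%:R `^ (p - 1).
    by rewrite -[leLHS](powRr0 k.+1%:R) ler_powR// ler1n.
  have : k%:R * k%:R `^ (p - 1) <= k%:R * k.+1%:R `^ (p - 1) by rewrite ler_wpM2l// ltW.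
  by move=> h3; rewrite -{1}natr1 mulrDl mul1r; lra.
rewrite -mulrBr ler_pdivlMl// mulrBl mul1r lerB// -expRD ler_expR.
have : q * (k%:R `^ p + 1) <= q * k.+1%:R `^ p by rewrite ler_pM2l.
lra.
Qed.

(** Telescoping against a multiple of [g k = (k + A)^(1-p) exp (- q k^p)].  The
    derivative of [- g] is [exp (- q k^p)] times
    [q p k^(p-1) (k+A)^(1-p) - (1-p) (k+A)^(-p)], where the first term is at
    least [q p] and the shift [A] makes the second at most half of that;
    Bernoulli's inequality gives the same bounds for increments. *)
Lemma tail_exp_lt1 (p q : R) : 0 < p < 1 -> 0 < q -> exists2 C : R, 0 < C &
  forall m N, (0 < m)%N ->
  \sum_(m <= k < N) expR (- (q * k%:R `^ p)) <=
  C * (expR (- (q * m%:R `^ p)) * m%:R `^ (1 - p)).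
Proof.
move=> /andP[p0 p1] q0; have pq0 : 0 < q * p by rewrite mulr_gt0.
have r0 : 0 < 1 - p by rewrite subr_gt0.
(* The choice of [A] makes [A ^ (-p)] at most [q p / 2]. *)
pose A := (1 + 2 / (q * p)) `^ p^-1.
have A1 : 1 <= A.
  rewrite -[leLHS](congr1 (@^~ p^-1) (powR1 R)); apply: ge0_ler_powR;
    rewrite ?nnegrE ?invr_ge0 ?(ltW p0)//.
    by rewrite addr_ge0// divr_ge0// ltW.
  by rewrite lerDl divr_ge0// ltW.
have Ap : A `^ p = 1 + 2 / (q * p).
  rewrite -powRrM mulVf ?gt_eqF// powRr1//.
  by rewrite addr_ge0// divr_ge0// ltW.
pose e := q * p / 2 * expR (- q).
have e0 : 0 < e by rewrite mulr_gt0 ?expR_gt0// divr_gt0.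
exists (e^-1 * (1 + A) `^ (1 - p)).
  by rewrite mulr_gt0 ?invr_gt0// powR_gt0// addr_gt0// (lt_le_trans ltr01).
move=> m N m0; pose g k := e^-1 * ((k%:R + A) `^ (1 - p) * expR (- (q * k%:R `^ p))).
have gm : g m <= e^-1 * (1 + A) `^ (1 - p) * (expR (- (q * m%:R `^ p)) * m%:R `^ (1 - p)).
  rewrite /g -mulrA ler_wpM2l ?invr_ge0 ?(ltW e0)// [leRHS]mulrCA [leLHS]mulrC.
  have A0 : 0 <= A := le_trans ler01 A1.
  have mA : m%:R + A <= (1 + A) * m%:R.
    by rewrite mulrDl mul1r lerD2l ler_peMr// ler1n.
  rewrite ler_wpM2l ?expR_ge0// -powRM ?addr_ge0//.
  apply: ge0_ler_powR; rewrite ?nnegrE /=.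
  - exact: ltW.
  - exact: addr_ge0.
  - by rewrite mulr_ge0 ?addr_ge0.
  - exact: mA.
apply: le_trans gm; apply: telescoping_tail => [k mk|k]; last first.
  by rewrite mulr_ge0 ?invr_ge0 ?(ltW e0)// mulr_ge0 ?powR_ge0 ?expR_ge0.
have k1 : 1 <= k%:R :> R by rewrite ler1n (leq_trans m0).
have k0 : 0 < k%:R :> R by rewrite (lt_le_trans ltr01).
set x := k%:R : R; set y := k.+1%:R : R; have yE : y = x + 1 by rewrite /y -natr1.
have y0 : 0 < y by rewrite /y.
set X := (x + A) `^ (1 - p); set Y := (y + A) `^ (1 - p).
have xA0 : 0 < x + A by rewrite addr_gt0// (lt_le_trans ltr01).
have X0 : 0 < X by rewrite powR_gt0.
have d1 : p * y `^ (p - 1) <= y `^ p - x `^ p.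
  have xy : 0 < x / y by rewrite divr_gt0.
  have := powR_le_linear xy (p := p); rewrite (ltW p0) (ltW p1) => /(_ isT) h.
  have xE : x `^ p = y `^ p * (x / y) `^ p.
    by rewrite -powRM ?(ltW y0) ?(ltW xy)// mulrCA mulfV ?mulr1// gt_eqF.
  rewrite xE -(mulr_powRB1 (ltW y0) p0); move: h; set r := (x / y) `^ p => h.
  rewrite [leRHS](_ : _ = y * (1 - r) * y `^ (p - 1)); last by ring.
  rewrite ler_wpM2r ?powR_ge0//.
  have : y * r <= y * (1 + p * (x / y - 1)) by rewrite ler_pM2l.
  have -> : y * (1 + p * (x / y - 1)) = y - p.
    by rewrite yE; field; rewrite -yE gt_eqF.
  lra.
have d2 : y `^ p - x `^ p <= 1.
  have xi : 0 < y / x by rewrite divr_gt0.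
  have := powR_le_linear xi (p := p); rewrite (ltW p0) (ltW p1) => /(_ isT) h.
  have yE' : y `^ p = x `^ p * (y / x) `^ p.
    by rewrite -powRM ?(ltW k0) ?(ltW xi)// mulrCA mulfV ?mulr1// gt_eqF.
  have : x `^ p * (y / x) `^ p <= x `^ p * (1 + p * (y / x - 1)) by rewrite ler_wpM2l ?powR_ge0.
  have xp : x `^ p <= x by rewrite ler1_powR// ltW.
  have -> : x `^ p * (1 + p * (y / x - 1)) = x `^ p + p * (x `^ p / x).
    by rewrite yE; field; rewrite gt_eqF.
  have : p * (x `^ p / x) <= 1 * 1.
    by rewrite ler_pM ?(ltW p0) ?(ltW p1) ?divr_ge0 ?powR_ge0 ?(ltW k0)// ler_pdivrMr// mul1r.
  rewrite -yE'; lra.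
have YX : Y <= X * (1 + (1 - p) / (x + A)).
  have xi : 0 < (y + A) / (x + A) by rewrite divr_gt0// addr_gt0// (lt_le_trans ltr01).
  have := powR_le_linear xi (p := 1 - p); rewrite (ltW r0) /= => /(_ _)/wrap[|h].
    by rewrite gerBl ltW.
  have -> : Y = X * ((y + A) / (x + A)) `^ (1 - p).
    by rewrite -powRM ?(ltW xA0) ?(ltW xi)// mulrCA mulfV ?mulr1// gt_eqF.
  rewrite ler_wpM2l ?(ltW X0)// (le_trans h)// lerD2l ler_wpM2l ?(ltW r0)//.
  by rewrite le_eqVlt; apply/orP; left; apply/eqP; rewrite yE; field; rewrite gt_eqF.
have Xq : q * p <= X * (q * (y `^ p - x `^ p)).
  apply: (@le_trans _ _ (X * (q * (p * y `^ (p - 1))))); last first.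
    by rewrite ler_pM2l// ler_pM2l.
  have yX : y `^ (1 - p) <= X.
    apply: ge0_ler_powR; rewrite ?nnegrE ?(ltW r0) ?(ltW y0) ?(ltW xA0)//.
    by rewrite yE lerD2l.
  have : y `^ (1 - p) * y `^ (p - 1) = 1.
    by rewrite -powRD_gt0// (_ : 1 - p + (p - 1) = 0) ?powRr0//; ring.
  have : y `^ (1 - p) * y `^ (p - 1) <= X * y `^ (p - 1) by rewrite ler_wpM2r ?powR_ge0.
  move=> h1 h2; rewrite h2 in h1.
  have : q * p * 1 <= q * p * (X * y `^ (p - 1)) by rewrite ler_pM2l.
  lra.
have XA : X * ((1 - p) / (x + A)) <= q * p / 2.
  have -> : X = (x + A) / (x + A) `^ p.
    by rewrite /X powRD_gt0// powRr1 ?(ltW xA0)// powRN.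
  rewrite [leLHS](_ : _ = (1 - p) / (x + A) `^ p); last first.
    by field; rewrite !gt_eqF// powR_gt0.
  have h : A `^ p <= (x + A) `^ p.
    apply: ge0_ler_powR; rewrite ?nnegrE ?(ltW p0) ?(ltW xA0) ?(le_trans ler01 A1)//.
    by rewrite lerDr ltW.
  rewrite ler_pdivrMr ?powR_gt0//.
  apply: (@le_trans _ _ (q * p / 2 * A `^ p)); last first.
    by rewrite ler_wpM2l// divr_ge0// ltW.
  rewrite Ap (_ : q * p / 2 * _ = q * p / 2 + 1); last by field; rewrite !gt_eqF.
  by move: pq0 p0; lra.
set D := y `^ p - x `^ p in d1 d2 Xq.
have yp : y `^ p = x `^ p + D by rewrite /D addrC subrK.
rewrite /g -mulrBr ler_pdivlMl// -/x -/y yp mulrDr opprD expRD -/X -/Y.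
rewrite mulrC [Y * _]mulrCA -[X * _]mulrC -mulrBr ler_wpM2l ?expR_ge0//.
have : X * (1 + q * D) <= X * expR (q * D) by rewrite ler_pM2l// expR_ge1Dx.
have eD : expR (- q) <= expR (- (q * D)).
  by rewrite ler_expR lerN2 -[leRHS]mulr1 ler_pM2l.
have eE : expR (q * D) * expR (- (q * D)) = 1 by rewrite -expRD subrr expR0.
move=> h.
have h' : q * p / 2 <= X * expR (q * D) - Y.
  by move: YX Xq XA h; rewrite !mulrDr !mulr1; lra.
have : q * p / 2 * expR (- (q * D)) <= (X * expR (q * D) - Y) * expR (- (q * D)).
  by rewrite ler_wpM2r ?expR_ge0.
rewrite [leRHS](_ : _ = X * (expR (q * D) * expR (- (q * D))) - Y * expR (- (q * D))).
  rewrite eE mulr1; apply: le_trans.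
  by rewrite /e ler_wpM2l// divr_ge0// ltW.
by ring.
Qed.

End TailSums.



(** * From coefficients to functions *)

Section Complex.
Variable R : realType.
Local Notation mu := (@lebesgue_measure R).
Local Open Scope complex_scope.

Lemma cmod_sqr (x y : R) : cmod (x +i* y) ^+ 2 = x ^+ 2 + y ^+ 2.
Proof. by rewrite /= sqr_sqrtr// addr_ge0 ?sqr_ge0. Qed.

Lemma cmod_sqrE (z : R[i]) : cmod z ^+ 2 = cRe z ^+ 2 + cIm z ^+ 2.
Proof. by case: z => x y; exact: cmod_sqr. Qed.

Lemma Re_mul_real (z : R[i]) (r : R) : cRe (z * r%:C) = cRe z * r.
Proof. by case: z => x y; simpc. Qed.

Lemma Im_mul_real (z : R[i]) (r : R) : cIm (z * r%:C) = cIm z * r.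
Proof. by case: z => x y; simpc. Qed.

Lemma sum_real_complex (X : seq R) (u p q : R -> R) :
  \sum_(x <- X) ((u x)%:C * (p x +i* q x)) =
  (\sum_(x <- X) u x * p x) +i* (\sum_(x <- X) u x * q x).
Proof.
elim: X => [|x X IH]; first by rewrite !big_nil.
by rewrite !big_cons IH; simpc.
Qed.

Lemma is_L2_sqr_integrable (f : R -> R[i]) : is_L2 f ->
  mu.-integrable setT (fun x => (cmod (f x) ^+ 2)%:E).
Proof.
case=> mr mi; rewrite /finite_norm => f2.
have mc : measurable_fun [set: R] (fun x => cmod (f x) ^+ 2).
  rewrite (_ : (fun x => _) = (fun x => cRe (f x) ^+ 2 + cIm (f x) ^+ 2)).
    by apply: measurable_funD; exact: measurable_funX.
  by apply/funext => x; rewrite cmod_sqrE.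
apply/integrableP; split; first exact/measurable_EFinP.
have := @poweR_Lnorm _ _ R mu (EFin \o (fun x => cmod (f x))) 2.
rewrite pnatr_eq0 => /(_ isT) E.
have -> : (\int[mu]_x `|(cmod (f x) ^+ 2)%:E|)%E =
    (\int[mu]_x (`|(EFin \o (fun x => cmod (f x))) x| `^ 2))%E.
  apply: eq_integral => x _ /=; congr (_%:E).
  by rewrite powR_mulrn ?normr_ge0// normrX.
by rewrite -E; apply: poweR_lty.
Qed.

Lemma L2_mul_integrable (f : R -> R[i]) (u g : R -> R) : is_L2 f ->
  measurable_fun [set: R] u -> (forall x, u x ^+ 2 <= cmod (f x) ^+ 2) ->
  measurable_fun [set: R] g -> mu.-integrable setT (EFin \o (fun x => g x ^+ 2)) ->
  mu.-integrable setT (EFin \o (fun x => u x * g x)).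
Proof.
move=> f2 mu_ uf mg ig.
apply: (@le_integrable _ _ R mu setT measurableT _
   (fun x => ((cmod (f x) ^+ 2)%:E + (g x ^+ 2)%:E)%E)).
- by apply/measurable_EFinP; exact: measurable_funM.
- move=> x _ /=; rewrite lee_fin normrM [leRHS]ger0_norm ?addr_ge0 ?sqr_ge0//.
  have := uf x; rewrite -[u x ^+ 2]real_normK ?num_real//.
  rewrite -[g x ^+ 2]real_normK ?num_real//.
  move: (`|u x|) (`|g x|) (normr_ge0 (u x)) (normr_ge0 (g x)) => y z y0 z0.
  have := sqr_ge0 (y - z); rewrite sqrrB; have : 0 <= y * z by rewrite mulr_ge0.
  by move: (y * z) (y ^+ 2) (z ^+ 2) (cmod _ ^+ 2) (sqr_ge0 y) (sqr_ge0 z) => yz y2 z2 m2; lra.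
- by apply: integrableD => //; exact: is_L2_sqr_integrable.
Qed.

Lemma wnorm_le1 (h : nat -> R -> R) (w : nat -> R) (f : R -> R[i]) :
  (forall k, 0 < w k) -> (wnorm h w f <= 1)%E ->
  forall N, \sum_(0 <= k < N) (w k * cRe (coef h f k) ^+ 2 + w k * cIm (coef h f k) ^+ 2) <= 1.
Proof.
move=> w0; rewrite /wnorm; set S := (\sum_(0 <= k <oo) _)%E => S1 N.
have u0 k : (0 <= (w k * cmod (coef h f k) ^+ 2)%:E)%E.
  by rewrite lee_fin mulr_ge0 ?sqr_ge0// ltW.
have S1' : (S <= 1)%E.
  rewrite -(@lee_sqrt R S 1)// (_ : sqrte 1 = 1%E)//.
  by rewrite /= sqrtr1.
rewrite -lee_fin; apply: le_trans S1'.
apply: le_trans (nneseries_lim_ge N (fun k _ _ => u0 k)).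
rewrite sumEFin lee_fin; apply: ler_sum => k _.
by rewrite cmod_sqrE mulrDr.
Qed.

End Complex.

Lemma lim_add_le (R : realType) (u v : nat -> R) (B : R) : cvgn u -> cvgn v ->
  (forall N, u N + v N <= B) -> limn u + limn v <= B.
Proof.
move=> cu cv uvB.
have cuv : (u N + v N) @[N --> \oo] --> limn u + limn v by exact: cvgD.
rewrite -(cvg_lim _ cuv)//; apply: limr_le; last by near=> N; exact: uvB.
by apply/cvg_ex; eexists; exact: cuv.
Unshelve. all: by end_near. Qed.

Section Assembly.
Variables (R : realType) (a : nat) (H : nat -> {poly R}).
Hypothesis a_gt1 : (1 < a)%N.
Hypothesis a_even : ~~ odd a.
Hypothesis H_on : orthonormal_polys (weight a) H.
Local Notation mu := (@lebesgue_measure R).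
Local Open Scope complex_scope.
Let W : R -> R := weight a.
Let h := hfun W H.
Let c : R := 2 * pi.
Local Notation kappa := (kappa R a).

Let c_ge4 : 4 <= c. Proof. by have := pi_ge2 R; rewrite /c; lra. Qed.
Let c_ge2 : 2 <= c. Proof. by move: c_ge4; lra. Qed.

Lemma weightE x : W x = expR (- (c / 2 * x ^+ a)).
Proof.
have cE : c / 2 = pi by rewrite /c; lra.
by rewrite /W /weight even_pow_norm// cE.
Qed.

Lemma weight_gt0 x : 0 < W x. Proof. exact: expR_gt0. Qed.

Lemma weight_sqr x : W x ^+ 2 = expR (expo a c).[x].
Proof. by rewrite weightE -expRM_natl hornerZ hornerXn; congr expR; lra. Qed.

Lemma hfunE k x : h k x = (H k).[x] * expR (- (c / 2 * x ^+ a)).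
Proof. by rewrite /h /hfun weightE. Qed.

Lemma poly_weight_integrable (P : {poly R}) :
  mu.-integrable setT (EFin \o (fun x => (P.[x] * W x) ^+ 2)).
Proof.
have := integrable_polyexp a_gt1 a_even c_ge2 (P ^+ 2); apply: eq_integrable => // x _ /=.
by rewrite exprMn weight_sqr /polyexp horner_exp.
Qed.

Lemma measurable_weight : measurable_fun [set: R] W.
Proof.
have := @measurable_polyexp R 1 (- (c / 2) *: 'X^a).
rewrite (_ : polyexp _ _ = W)//; apply/funext => x.
by rewrite /polyexp weightE hornerC mul1r hornerZ hornerXn mulNr.
Qed.

Lemma weight_integral_coef (f : R -> R[i]) : is_L2 f ->
  cintegral (fun x => f x * (W x)%:C) =
  (cRe (coef h f 0) / lead_coef (H 0)) +i* (cIm (coef h f 0) / lead_coef (H 0)).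
Proof.
move=> f2; have [mr mi _] := f2; have [size_H lead_H _] := H_on.
have l0 : lead_coef (H 0) != 0 by rewrite lt0r_neq0.
have iW := poly_weight_integrable 1.
have iW' : mu.-integrable setT (EFin \o (fun x => W x ^+ 2)).
  by apply: eq_integrable iW => // x _ /=; rewrite hornerC mul1r.
have h0 x : h 0 x = lead_coef (H 0) * W x.
  by rewrite /h /hfun {1}(H0E size_H) hornerC.
have part (u : R -> R) : measurable_fun [set: R] u ->
    (forall x, u x ^+ 2 <= cmod (f x) ^+ 2) ->
    \int[mu]_x (u x * W x) = (\int[mu]_x (u x * h 0 x)) / lead_coef (H 0).
  move=> mu_ uf; have iu := L2_mul_integrable f2 mu_ uf measurable_weight iW'.
  rewrite (_ : \int[mu]_x (u x * h 0 x) = lead_coef (H 0) * \int[mu]_x (u x * W x)).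
    by rewrite mulrC mulKf.
  by rewrite -RintegralZl//; apply: eq_Rintegral => x _; rewrite h0 mulrCA.
rewrite /cintegral /coef /inner /cintegral; congr (_ +i* _).
  transitivity (\int[mu]_x (cRe (f x) * W x)).
    by apply: eq_Rintegral => x _; rewrite Re_mul_real.
  rewrite part//; last by move=> x; rewrite cmod_sqrE lerDl sqr_ge0.
  congr (_ / _); apply: eq_Rintegral => x _.
  by rewrite conjc_real Re_mul_real.
transitivity (\int[mu]_x (cIm (f x) * W x)).
  by apply: eq_Rintegral => x _; rewrite Im_mul_real.
rewrite part//; last by move=> x; rewrite cmod_sqrE lerDr sqr_ge0.
congr (_ / _); apply: eq_Rintegral => x _.
by rewrite conjc_real Im_mul_real.
Qed.

Lemma cont_repE (f : R -> R[i]) x : cont_rep h f x =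
  (limn (series (fun k => cRe (coef h f k) * h k x))) +i*
  (limn (series (fun k => cIm (coef h f k) * h k x))).
Proof.
rewrite /cont_rep /cseries; congr (_ +i* _); congr (limn (series _)); apply/funext => k.
  exact: Re_mul_real.
exact: Im_mul_real.
Qed.

Lemma omegaE n x : root (H n) x ->
  omega W h n x = cotes H n x * expR (c / 2 * x ^+ a).
Proof.
move=> /rootP Hx; rewrite /omega big_nat_recr //= /h {2}/hfun Hx mul0r normr0 expr0n /= addr0.
rewrite (_ : \sum_(0 <= k < n) _ = W x ^+ 2 * \sum_(k < n) (H k).[x] ^+ 2).
  rewrite invfM mulrA mulrC /cotes; congr (_ * _).
  rewrite expr2 invfM mulrA mulfV ?gt_eqF ?weight_gt0// mul1r.
  by rewrite weightE expRN invrK.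
rewrite big_mkord mulr_sumr; apply: eq_bigr => k _.
by rewrite /hfun real_normK ?num_real// exprMn mulrC.
Qed.

(** Real and imaginary parts are treated separately; [S] of each is its share of
    the squared norm of [f], and the two shares add up to at most 1. *)
Lemma quad_error_le : exists2 C : R, 0 < C &
  forall (w D : nat -> R) n (f : R -> R[i]), (0 < n)%N -> (forall k, 0 < w k) ->
  (forall m N, (0 < m)%N -> \sum_(m.*2 <= k < N) (kappa k)^-1 / w k <= D m) ->
  is_L2 f -> (wnorm h w f <= 1)%E ->
  cmod (quad_error W h n f) ^+ 2 <= C * D n.
Proof.
have [size_H lead_H on] := H_on.
have [L LE] := wint_scalar a_gt1 a_even c_ge2.
have H_orthonormal j k : L (H j * H k) = (j == k)%:R.
  rewrite LE -on; apply: eq_Rintegral => x _.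
  by rewrite /polyexp hornerM -/W weight_sqr.
have [C C0 err] := quadrature_error_real a_gt1 a_even c_ge4 LE size_H lead_H H_orthonormal.
exists C => // w D n f n0 w0 hD f2 f1.
have [X [uX sX rX]] := orthogonal_roots size_H lead_H H_orthonormal
  (L_gt0 a_gt1 a_even c_ge2 LE) n.
have aX : all (root (H n)) X by apply/allP => x; rewrite rX.
have nodesE : nodes h n = [set` X].
  apply/seteqP; split => x; rewrite /nodes /= rX /root hfunE => hx.
    by move/eqP: hx; rewrite mulf_eq0 (gt_eqF (expR_gt0 _)) orbF.
  by rewrite (eqP hx) mul0r.
have -> : quad_error W h n f =
   (cRe (coef h f 0) / lead_coef (H 0) - \sum_(x <- X) omega W h n x *
      limn (series (fun k => cRe (coef h f k) * h k x))) +i*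
   (cIm (coef h f 0) / lead_coef (H 0) - \sum_(x <- X) omega W h n x *
      limn (series (fun k => cIm (coef h f k) * h k x))).
  rewrite /quad_error weight_integral_coef// nodesE -fsbig_seq//.
  under eq_bigr => x _ do rewrite cont_repE.
  by rewrite sum_real_complex; simpc.
rewrite cmod_sqr.
set ra := fun k => cRe (coef h f k); set ia := fun k => cIm (coef h f k).
pose S (u : nat -> R) N := \sum_(0 <= k < N) w k * u k ^+ 2.
have S1 N : S ra N + S ia N <= 1.
  by have := wnorm_le1 w0 f1 N; rewrite big_split.
have S0 u N : 0 <= S u N by apply: sumr_ge0 => k _; rewrite mulr_ge0 ?sqr_ge0// ltW.
have Smono u : nondecreasing_seq (S u).
  by apply/nondecreasing_seqP => N; rewrite /S big_nat_recr//= lerDl mulr_ge0 ?sqr_ge0// ltW.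
have Scv u : (forall N, S u N <= 1) -> cvgn (S u).
  by move=> uB; apply: nondecreasing_is_cvgn => //; exists 1 => _ [N _ <-].
have ra1 : cvgn (S ra).
  by apply: Scv => N; rewrite (le_trans _ (S1 N))// lerDl.
have ia1 : cvgn (S ia).
  by apply: Scv => N; rewrite (le_trans _ (S1 N))// lerDr.
have lim1 : limn (S ra) + limn (S ia) <= 1.
  exact: lim_add_le ra1 ia1 S1.
have bound (u : nat -> R) : cvgn (S u) ->
    (u 0 / lead_coef (H 0) - \sum_(x <- X) omega W h n x *
      limn (series (fun k => u k * h k x))) ^+ 2 <= limn (S u) * (C * D n).
  move=> cu; have uB N : S u N <= limn (S u) by exact: nondecreasing_cvgn_le.
  have := err w u D (limn (S u)) n X n0 uX sX aX w0 uB hD.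
  rewrite [X in _ - X](_ : _ = \sum_(x <- X) omega W h n x *
      limn (series (fun k => u k * h k x)))//.
  rewrite !big_seq; apply: eq_bigr => x xX; rewrite omegaE -?rX//.
  have -> // : (fun k => u k * h k x) =
      (fun k => u k * ((H k).[x] * expR (- (c / 2 * x ^+ a)))).
  by apply/funext => k; rewrite hfunE.
have D0 : 0 <= C * D n.
  by rewrite mulr_ge0 ?(ltW C0)//; have := hD n 0 n0; rewrite big_geq.
apply: (@le_trans _ _ (limn (S ra) * (C * D n) + limn (S ia) * (C * D n))).
  by rewrite lerD ?bound.
by rewrite -mulrDl ler_piMl.
Qed.

End Assembly.

(** * The two spaces *)

Lemma Hs_tail (R : realType) (a : nat) (s : R) : (1 < a)%N ->
  1 - a%:R^-1 < s -> exists2 C : R, 0 < C & forall m N, (0 < m)%N ->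
  \sum_(m.*2 <= k < N) (kappa R a k)^-1 / (1 + k%:R) `^ s <=
  C * m%:R `^ (- s + 1 - a%:R^-1).
Proof.
move=> a1 sa; have ai : a%:R^-1 <= 1 :> R by rewrite invf_le1 ?ler1n ?ltr0n ltnW.
have s0 : 0 < s by lra.
have t1 : 1 < s + a%:R^-1 by lra.
have [C C0 tail] := tail_powR t1; exists C => // m N m0.
apply: (@le_trans _ _ (\sum_(m.*2 <= k < N) k%:R `^ (- (s + a%:R^-1)))).
  apply: ler_sum_nat => k /andP[mk _].
  have k0 : 0 < k%:R :> R by rewrite ltr0n (leq_trans _ mk)// double_gt0.
  rewrite opprD [- s + _]addrC powRD_gt0// !powRN ler_wpM2l ?invr_ge0 ?powR_ge0//.
  rewrite lef_pV2 ?posrE ?powR_gt0 ?addr_gt0//.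
  by apply: ge0_ler_powR; rewrite ?nnegrE ?(ltW s0) ?addr_ge0// lerDr.
apply: le_trans (tail _ _ _) _; first by rewrite double_gt0.
rewrite ler_wpM2l ?(ltW C0)// (_ : - s + 1 - a%:R^-1 = - (s + a%:R^-1 - 1)); last by ring.
rewrite (_ : 1 - _ = - (s + a%:R^-1 - 1)); last by ring.
rewrite !powRN lef_pV2 ?posrE ?powR_gt0 ?ltr0n ?double_gt0//.
apply: ge0_ler_powR; rewrite ?nnegrE ?subr_ge0 ?(ltW t1)//.
by rewrite ler_nat -addnn leq_addr.
Qed.

Lemma Epq_tail (R : realType) (a : nat) (p q : R) : (1 < a)%N -> 0 < p -> 0 < q ->
  exists2 C : R, 0 < C & forall m N, (0 < m)%N ->
  \sum_(m.*2 <= k < N) (kappa R a k)^-1 / expR (q * k%:R `^ p) <=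
  C * (expR (- (q * (2 * m)%:R `^ p)) * m%:R `^ (3^-1 - a%:R^-1 + Num.max (1 - p) 0)).
Proof.
move=> a1 p0 q0; set e := Num.max _ _.
have [C C0 tail] : exists2 C : R, 0 < C & forall m N, (0 < m)%N ->
    \sum_(m <= k < N) expR (- (q * k%:R `^ p)) <=
    C * (expR (- (q * m%:R `^ p)) * m%:R `^ e).
  have [p1|p1] := leP 1 p.
    have [C C0 tail] := tail_exp_ge1 p1 q0; exists C => // m N m0.
    rewrite /e max_r ?subr_le0// powRr0 mulr1; exact: tail.
  have [|C C0 tail] := @tail_exp_lt1 R p q _ q0; first by rewrite p0.
  exists C => // m N m0; rewrite /e max_l ?subr_ge0 ?(ltW p1)//; exact: tail.
exists (C * 2 `^ e); first by rewrite mulr_gt0// powR_gt0.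
move=> m N m0; have m0' : 0 < m%:R :> R by rewrite ltr0n.
have m1 : 1 <= m%:R :> R by rewrite ler1n.
have ai : 0 <= a%:R^-1 :> R by rewrite invr_ge0.
have km k : (m.*2 <= k)%N -> (kappa R a k)^-1 <= m%:R `^ (- a%:R^-1).
  move=> mk; have mk' : (m <= k)%N by rewrite (leq_trans _ mk)// -addnn leq_addr.
  rewrite powRN lef_pV2 ?posrE ?powR_gt0 ?ltr0n ?(leq_trans m0)//.
  by apply: ge0_ler_powR; rewrite ?nnegrE// ler_nat.
apply: (@le_trans _ _ (m%:R `^ (- a%:R^-1) * \sum_(m.*2 <= k < N) expR (- (q * k%:R `^ p)))).
  rewrite mulr_sumr; apply: ler_sum_nat => k /andP[mk _].
  by rewrite -expRN ler_wpM2r ?expR_ge0// km.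
have m20 : (0 < m.*2)%N by rewrite double_gt0.
apply: le_trans (ler_wpM2l (powR_ge0 _ _) (tail _ N m20)) _.
rewrite -mul2n; set E := expR _; rewrite natrM powRM//.
rewrite [leLHS](_ : _ = C * 2 `^ e * (E * (m%:R `^ (- a%:R^-1) * m%:R `^ e))); last by ring.
rewrite ler_wpM2l ?mulr_ge0 ?powR_ge0 ?(ltW C0)// ler_wpM2l ?expR_ge0//.
by rewrite -powRD_gt0// ler_powR// lerD2r lerDr invr_ge0.
Qed.

Theorem theorem3p1 (R : realType) (alpha : nat) (H : nat -> {poly R})
    (s p q : R)
    (alpha_gt1 : (1 < alpha)%N) (alpha_even : ~~ odd alpha)
    (H_orthonormal : orthonormal_polys (weight alpha) H)
    (s_gt : 1 - alpha%:R^-1 < s) (p_gt0 : 0 < p) (q_gt0 : 0 < q) :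
  let W : R -> R := weight alpha in
  let h := hfun W H in
  (exists C : R, 0 < C /\ forall n : nat, (1 <= n)%N ->
     (ereal_sup [set (cmod (quad_error W h n f) ^+ 2)%:E
                | f in [set f | Hs_space h s f /\ Hs_norm h s f <= 1]]
      <= (C * n%:R `^ (- s + 1 - alpha%:R^-1))%:E)%E) /\
  (exists C : R, 0 < C /\ forall n : nat, (1 <= n)%N ->
     (ereal_sup [set (cmod (quad_error W h n f) ^+ 2)%:E
                | f in [set f | Epq_space h p q f /\ Epq_norm h p q f <= 1]]
      <= (C * (expR (- (q * (2 * n)%:R `^ p))
               * n%:R `^ (3^-1 - alpha%:R^-1 + Num.max (1 - p) 0)))%:E)%E).
Proof.
move=> W h; have [C C0 err] := quad_error_le alpha_gt1 alpha_even H_orthonormal.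
split.
  have [C' C'0 tail] := Hs_tail alpha_gt1 s_gt.
  exists (C * C'); split; first exact: mulr_gt0.
  move=> n n0; apply: ub_ereal_sup => _ [f [[f2 _] f1] <-].
  rewrite lee_fin -mulrA; move: f1; rewrite /Hs_norm => f1.
  pose D m : R := C' * m%:R `^ (- s + 1 - alpha%:R^-1).
  by apply: (err (fun k => (1 + k%:R) `^ s) D) f1.
have [C' C'0 tail] := Epq_tail alpha_gt1 p_gt0 q_gt0.
exists (C * C'); split; first exact: mulr_gt0.
move=> n n0; apply: ub_ereal_sup => _ [f [[f2 _] f1] <-].
rewrite lee_fin -mulrA; move: f1; rewrite /Epq_norm => f1.
pose D m : R := C' * (expR (- (q * (2 * m)%:R `^ p)) *
  m%:R `^ (3^-1 - alpha%:R^-1 + Num.max (1 - p) 0)).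
by apply: (err (fun k => expR (q * k%:R `^ p)) D) f1 => // k; exact: expR_gt0.
Qed.
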